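(* Let $V_h := H_{h,\mathrm{imp}}(\mathrm{div}) \times H_{h,\mathrm{imp}}(\mathrm{curl}) \times H_{h,0}(\mathrm{grad})$, let $\tau>0$, and let $a(\cdot;\cdot)$ be the bilinear form on $V_h\times V_h$ $$\begin{aligned} a(B,E,p;C,F,q) :={}& \tfrac{2}{\tau}\langle \mu^{-1}B,C\rangle + \langle \mu^{-1}\mathrm{curl}\,E,C\rangle + \langle \mathrm{div}\,B,\mathrm{div}\,C\rangle \\ &+ \tfrac{2}{\tau}\langle \varepsilon E,F\rangle + \langle \varepsilon\,\mathrm{grad}\,p,F\rangle - \langle \mu^{-1}B,\mathrm{curl}\,F\rangle + (1+\gamma)\langle E,F\rangle_{\Gamma_i} \\ &+ \tfrac{2}{\tau}\langle p,q\rangle - \langle \varepsilon E,\mathrm{grad}\,q\rangle . \end{aligned}$$ Define the weighted norms $$\|B\|_{\mathrm{div}}^2 := \tfrac{2}{\tau}\|B\|_{\mu^{-1}}^2 + \|\mathrm{div}\,B\|^2,$$ $$\|E\|_{\mathrm{curl}}^2 := \tfrac{2}{\tau}\|E\|_{\varepsilon}^2 + \tfrac{\tau}{2}\|\mathrm{curl}\,E\|_{\mu^{-1}}^2 + (1+\gamma)\|E\|_{\Gamma_i}^2,$$ $$\|p\|_{\mathrm{grad}}^2 := \tfrac{2}{\tau}\|p\|^2 + \tfrac{\tau}{2}\|\mathrm{grad}\,p\|_{\varepsilon}^2 .$$ Then for all $(B,E,p)\in V_h$ the inf-sup condition $$\sup_{0\neq (C,F,q)\in V_h} \frac{a(B,E,p;C,F,q)}{\left(\|C\|_{\mathrm{div}}^2+\|F\|_{\mathrm{curl}}^2+\|q\|_{\mathrm{grad}}^2\right)^{1/2}}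 \;\geq\; \frac14\left(\|B\|_{\mathrm{div}}^2+\|E\|_{\mathrm{curl}}^2+\|p\|_{\mathrm{grad}}^2\right)^{1/2}$$ holds, and there is a constant $C_0$, independent of the mesh, $\tau$, $\varepsilon$ and $\mu$, such that for all $(B,E,p),(C,F,q)\in V_h$ $$a(B,E,p;C,F,q) \leq C_0\left(\|B\|_{\mathrm{div}}^2+\|E\|_{\mathrm{curl}}^2+\|p\|_{\mathrm{grad}}^2\right)^{1/2}\left(\|C\|_{\mathrm{div}}^2+\|F\|_{\mathrm{curl}}^2+\|q\|_{\mathrm{grad}}^2\right)^{1/2}.$$ Consequently, the following (auxiliary) problem is well-posed: given functionals $g_B, g_E, g_p$ on $H_{h,\mathrm{imp}}(\mathrm{div})$, $H_{h,\mathrm{imp}}(\mathrm{curl})$, $H_{h,0}(\mathrm{grad})$, find $(B,E,p)\in V_h$ such that $$a(B,E,p;C,F,q) = (g_B,C)+(g_E,F)+(g_p,q)\quad\text{for all }(C,F,q)\in V_h .$$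
   Context: Setting. $\Omega=\mathcal S\setminus\overline{\mathcal O}\subset\mathbb R^3$ is a bounded Lipschitz domain, where $\mathcal O$ is a bounded connected domain (the obstacle) and $\mathcal S$ is a large ball containing $\mathcal O$ (curved boundaries are replaced by polyhedral approximations so that $\Omega$ can be meshed by tetrahedra). $\Gamma_i=\partial\Omega\cap\partial\mathcal O$ and $\Gamma_o=\partial\Omega\setminus\Gamma_i$; $n$ is the unit normal on $\partial\Omega$. The coefficients $\varepsilon,\mu$ are positive continuous functions of $x$ on $\overline\Omega$, and $\gamma$ is a real constant with $1+\gamma\ge 0$. $\tau>0$ is a time step size. Notation. $\langle u,v\rangle=\int_\Omega u\cdot v\,dx$ and $\|u\|^2=\langle u,u\rangle$ (scalar or vector $L^2$); $\|u\|_\varepsilon^2=\langle\varepsilon u,u\rangle$, $\|u\|_{\mu^{-1}}^2=\langle\mu^{-1}u,u\rangle$. For a vector field $F$, $F_{\mathrm{tan}}=F-\langle F,n\rangle n$ on the boundary; $\langle E,F\rangle_{\Gamma_i}=\int_{\Gamma_i}E_{\mathrm{tan}}\cdot F_{\mathrm{tan}}$ and $\|E\|_{\Gamma_i}^2=\langle E,E\rangle_{\Gamma_i}$. Spaces. $H_0(\mathrm{grad})=H_0^1(\Omega)$; $H_{\mathrm{imp}}(\mathrm{curl})=\{v\in H(\mathrm{curl}): v\wedge n|_{\Gamma_o}=0\}$; $H_{\mathrm{imp}}(\mathrm{div})=\{v\in H(\mathrm{div}): v\cdot n|_{\Gamma_o}=0\}$. On a tetrahedral mesh of $\Omega$, $H_{h,0}(\mathrm{grad})\subset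 H_0(\mathrm{grad})$, $H_{h,\mathrm{imp}}(\mathrm{curl})\subset H_{\mathrm{imp}}(\mathrm{curl})$, $H_{h,\mathrm{imp}}(\mathrm{div})\subset H_{\mathrm{imp}}(\mathrm{div})$ are the Lagrange, Nédélec and Raviart–Thomas finite element spaces of matching order, so that $\mathrm{grad}$ maps $H_{h,0}(\mathrm{grad})$ into $H_{h,\mathrm{imp}}(\mathrm{curl})$, $\mathrm{curl}$ maps $H_{h,\mathrm{imp}}(\mathrm{curl})$ into $H_{h,\mathrm{imp}}(\mathrm{div})$, and $\mathrm{div}$ maps $H_{h,\mathrm{imp}}(\mathrm{div})$ into a piecewise polynomial space $L_h^2\subset L^2(\Omega)$. ''Well-posed'' means that for all data a solution exists, is unique, and depends continuously on the data, with respect to the norm $(\|B\|_{\mathrm{div}}^2+\|E\|_{\mathrm{curl}}^2+\|p\|_{\mathrm{grad}}^2)^{1/2}$ and its dual norm. *)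

(* Defs.v *)
From HB Require Import structures.
From mathcomp Require Import all_boot all_order all_algebra.
(* mpoly has to be imported before mathcomp-analysis: in the other order their
   notations clash. *)
From mathcomp Require Import mpoly.
From mathcomp Require Import all_classical all_reals all_analysis.

Set Implicit Arguments.
Unset Strict Implicit.
Unset Printing Implicit Defensive.

Import Order.TTheory GRing.Theory Num.Theory numFieldNormedType.Exports.

Local Open Scope classical_set_scope.
Local Open Scope ring_scope.

Section VectorCalculus.

(* Index arithmetic is in Z/3Z:
   (a x b)_i = a_(i+1) b_(i-1) - a_(i-1) b_(i+1). *)
Definition cross (A : nzRingType) (a b : 'I_3 -> A) (i : 'I_3) : A :=
  a (i + 1) * b (i - 1) - a (i - 1) * b (i + 1).

Variable R : realType.
Implicit Types u v n x : 'rV[R]_3.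

Definition dot u v : R := \sum_i u 0 i * v 0 i.

(* The norm `|u| of the library on 'rV[R]_3 is the sup norm. *)
Definition enorm u : R := Num.sqrt (dot u u).

Definition vprod u v : 'rV[R]_3 := \row_i cross (u 0) (v 0) i.

Definition tang n u : 'rV[R]_3 := u - dot u n *: n.

Definition spoly := {mpoly R[3]}.
Definition vpoly := {ffun 'I_3 -> {mpoly R[3]}}.

Definition seval (p : spoly) x : R := p.@[x 0].
Definition veval (w : vpoly) x : 'rV[R]_3 := \row_i (w i).@[x 0].

Definition pgrad (p : spoly) : vpoly := [ffun i => p^`M(i)].
Definition pcurl (w : vpoly) : vpoly :=
  [ffun i : 'I_3 => (w (i - 1))^`M(i + 1) - (w (i + 1))^`M(i - 1)].
Definition pdvg (w : vpoly) : spoly := \sum_i (w i)^`M(i).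

Definition deg_le (k : nat) (p : spoly) : Prop := (msize p <= k.+1)%N.

End VectorCalculus.

Section Integrals.

Variable R : realType.

Definition point3 (t : R * R * R) : 'rV[R]_3 :=
  \row_i nth 0 [:: t.1.1; t.1.2; t.2] i.

Definition vol_int (A : set 'rV[R]_3) (h : 'rV[R]_3 -> R) : R :=
  \int[((@lebesgue_measure R \x @lebesgue_measure R) \x @lebesgue_measure R)%E]_(t
    in point3 @^-1` A) h (point3 t).

(* Surface integral over the triangle with vertices a, b, c, by affine
   parametrization over the unit triangle. *)
Definition tri_int (a b c : 'rV[R]_3) (h : 'rV[R]_3 -> R) : R :=
  enorm (vprod (b - a) (c - a)) *
  \int[(@lebesgue_measure R \x @lebesgue_measure R)%E]_(s
    in [set s : R * R | [/\ 0 <= s.1, 0 <= s.2 & s.1 + s.2 <= 1]])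
    h (a + s.1 *: (b - a) + s.2 *: (c - a)).

End Integrals.

Section Domains.

Variable R : realType.
Implicit Types W S O : set 'rV[R]_3.

Definition domain W : Prop := [/\ open W, connected W & W !=set0].

Definition frontier W : set 'rV[R]_3 := closure W `\` W°.

(* Near each boundary point, and in suitable orthonormal coordinates centred at
   it, W is the strict epigraph of a Lipschitz function. *)
Definition lipschitz_domain W : Prop :=
  domain W /\
  forall x, frontier W x ->
    exists (Q : 'M[R]_3) (r L : R) (g : 'rV[R]_2 -> R),
      [/\ Q *m Q^T = 1%:M, 0 < r, L.-lipschitz g &
          forall y, ball x r y ->
            let y' := (y - x) *m Q in
            (W y <-> g (\row_(j < 2) y' 0 (inord j)) < y' 0 (inord 2))].

Definition exterior S O : set 'rV[R]_3 := S `\` closure O.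

Definition Gamma_i S O : set 'rV[R]_3 :=
  frontier (exterior S O) `&` frontier O.

Definition Gamma_o S O : set 'rV[R]_3 :=
  frontier (exterior S O) `\` Gamma_i S O.

(* S stands for a polyhedral approximation of a large ball, so it is only
   required to be a bounded domain containing the closure of the obstacle O. *)
Definition scattering_geometry S O : Prop :=
  [/\ domain O /\ bounded_set O,
      domain S /\ bounded_set S,
      closure O `<=` S &
      lipschitz_domain (exterior S O)].

Definition positive_coef W (w : 'rV[R]_3 -> R) : Prop :=
  {within closure W, continuous w} /\ (forall x, closure W x -> 0 < w x).

End Domains.

Section Meshes.

Variable R : realType.

Record tetmesh := TetMesh {
  nvtx : nat;
  ncell : nat;
  vtx : 'I_nvtx -> 'rV[R]_3;
  cell : 'I_ncell -> {set 'I_nvtx}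
}.

Variable m : tetmesh.

Definition hull (f : {set 'I_(nvtx m)}) : set 'rV[R]_3 :=
  [set x | exists w : 'I_(nvtx m) -> R,
     [/\ forall i, 0 <= w i, \sum_(i in f) w i = 1
       & x = \sum_(i in f) w i *: vtx i]].

Definition tet (c : 'I_(ncell m)) : set 'rV[R]_3 := hull (cell c).

Definition affine_free (f : {set 'I_(nvtx m)}) : Prop :=
  forall w : 'I_(nvtx m) -> R,
    \sum_(i in f) w i = 0 -> \sum_(i in f) w i *: vtx i = 0 ->
    forall i, i \in f -> w i = 0.

(* Conforming tetrahedral mesh of (the closure of) W. *)
Definition mesh_of (W : set 'rV[R]_3) : Prop :=
  [/\ injective (@cell m),
      forall c : 'I_(ncell m), #|cell c| = 4%N /\ affine_free (cell c),
      forall c d : 'I_(ncell m), tet c `&` tet d = hull (cell c :&: cell d) &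
      \bigcup_c tet c = closure W].

Definition is_face (c : 'I_(ncell m)) (f : {set 'I_(nvtx m)}) : bool :=
  (f \subset cell c) && (#|f| == 3%N).

Definition face_vtx (f : {set 'I_(nvtx m)}) (j : nat) : 'rV[R]_3 :=
  nth 0 [seq vtx i | i <- enum f] j.

(* The sign of the normal is arbitrary; nothing below depends on it. *)
Definition face_normal (f : {set 'I_(nvtx m)}) : 'rV[R]_3 :=
  let n := vprod (face_vtx f 1 - face_vtx f 0) (face_vtx f 2 - face_vtx f 0) in
  (enorm n)^-1 *: n.

Definition face_int (f : {set 'I_(nvtx m)}) (h : 'rV[R]_3 -> R) : R :=
  tri_int (face_vtx f 0) (face_vtx f 1) (face_vtx f 2) h.

End Meshes.

Section FiniteElements.

Variables (R : realType) (S O : set 'rV[R]_3) (m : tetmesh R) (k : nat).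

(* A piecewise polynomial function is given by its polynomial on each cell, so
   that two of them are equal exactly when they agree almost everywhere. The
   differential operators act cell by cell; on the conforming spaces below this
   is the weak grad, curl or div. *)
Definition sfield := {ffun 'I_(ncell m) -> {mpoly R[3]}}.
Definition vfield := {ffun 'I_(ncell m) -> {ffun 'I_3 -> {mpoly R[3]}}}.

Definition grad (p : sfield) : vfield := [ffun c => pgrad (p c)].
Definition curl (u : vfield) : vfield := [ffun c => pcurl (u c)].
Definition div (u : vfield) : sfield := [ffun c => pdvg (u c)].

(* Lagrange elements of degree k.+1: P_(k+1). *)
Definition Hh0_grad : set sfield := [set p : sfield |
  [/\ forall c, deg_le k.+1 (p c),
      forall c d x, tet c x -> tet d x -> seval (p c) x = seval (p d) x &
      forall c x, tet c x -> frontier (exterior S O) x -> seval (p c) x = 0]].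

(* Nedelec elements of the first kind: P_k^3 + x /\ P_k^3. *)
Definition nedelec_local (u : vpoly R) : Prop :=
  exists a b : vpoly R,
    [/\ forall i, deg_le k (a i), forall i, deg_le k (b i) &
        forall i, u i = a i + cross (fun j : 'I_3 => 'X_j : {mpoly R[3]}) b i].

Definition Hhimp_curl : set vfield := [set u : vfield |
  [/\ forall c, nedelec_local (u c),
      forall c d f x, is_face c f -> is_face d f -> hull f x ->
        vprod (veval (u c) x) (face_normal f) =
        vprod (veval (u d) x) (face_normal f) &
      forall c f x, is_face c f -> hull f `<=` Gamma_o S O -> hull f x ->
        vprod (veval (u c) x) (face_normal f) = 0]].

(* Raviart-Thomas elements: P_k^3 + x P_k. *)
Definition rt_local (u : vpoly R) : Prop :=
  exists (a : vpoly R) (b : spoly R),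
    [/\ forall i, deg_le k (a i), deg_le k b &
        forall i, u i = a i + 'X_i * b].

Definition Hhimp_div : set vfield := [set u : vfield |
  [/\ forall c, rt_local (u c),
      forall c d f x, is_face c f -> is_face d f -> hull f x ->
        dot (veval (u c) x) (face_normal f) =
        dot (veval (u d) x) (face_normal f) &
      forall c f x, is_face c f -> hull f `<=` Gamma_o S O -> hull f x ->
        dot (veval (u c) x) (face_normal f) = 0]].

(* Triples (B, E, p). *)
Definition fields : Type := (vfield * vfield * sfield)%type.
HB.instance Definition _ := GRing.Lmodule.on fields.

Definition Vh : set fields := [set x : fields |
  [/\ Hhimp_div x.1.1, Hhimp_curl x.1.2 & Hh0_grad x.2]].

Definition ip_s (w : 'rV[R]_3 -> R) (p q : sfield) : R :=
  \sum_c vol_int (tet c) (fun x => w x * (seval (p c) x * seval (q c) x)).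

Definition ip_v (w : 'rV[R]_3 -> R) (u v : vfield) : R :=
  \sum_c vol_int (tet c) (fun x => w x * dot (veval (u c) x) (veval (v c) x)).

Definition recip (w : 'rV[R]_3 -> R) : 'rV[R]_3 -> R := fun x => (w x)^-1.

(* A face in Gamma_i belongs to exactly one cell c, whose polynomial gives the
   trace. *)
Definition ip_Gi (u v : vfield) : R :=
  \sum_c \sum_(f | is_face c f && `[< hull f `<=` Gamma_i S O >])
    face_int f (fun x => dot (tang (face_normal f) (veval (u c) x))
                             (tang (face_normal f) (veval (v c) x))).

Variables (tau gamma : R) (eps mu : 'rV[R]_3 -> R).

Definition aform (x y : fields) : R :=
  let: (B, E, p) := x in let: (C, F, q) := y in
  2 / tau * ip_v (recip mu) B C + ip_v (recip mu) (curl E) C + ip_s (cst 1) (div B) (div C)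
  + 2 / tau * ip_v eps E F + ip_v eps (grad p) F - ip_v (recip mu) B (curl F)
  + (1 + gamma) * ip_Gi E F
  + 2 / tau * ip_s (cst 1) p q - ip_v eps E (grad q).

Definition sqnorm_div (B : vfield) : R :=
  2 / tau * ip_v (recip mu) B B + ip_s (cst 1) (div B) (div B).

Definition sqnorm_curl (E : vfield) : R :=
  2 / tau * ip_v eps E E + tau / 2 * ip_v (recip mu) (curl E) (curl E)
  + (1 + gamma) * ip_Gi E E.

Definition sqnorm_grad (p : sfield) : R :=
  2 / tau * ip_s (cst 1) p p + tau / 2 * ip_v eps (grad p) (grad p).

Definition norm_Vh (x : fields) : R :=
  Num.sqrt (sqnorm_div x.1.1 + sqnorm_curl x.1.2 + sqnorm_grad x.2).

End FiniteElements.

Arguments Vh {R} S O m k _.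

Section WellPosedness.

Variables (R : realType).

(* l is a linear functional on the subspace H; its values outside H are
   irrelevant. *)
Definition functional_on (V : lmodType R) (H : set V) (l : V -> R) : Prop :=
  forall (a : R) (u v : V), H u -> H v -> l (a *: u + v) = a * l u + l v.

(* If H = {0} the set is empty and sup returns 0. *)
Definition dual_norm (V : lmodType R) (H : set V) (nrm : V -> R) (l : V -> R)
    : R :=
  sup [set `|l y| / nrm y | y in [set y | H y /\ y != 0]].

(* For every g in data there is exactly one x in H with a(x, y) = g(y) for all y
   in H, and the linear map g |-> x is bounded from the dual norm to nrm. *)
Definition well_posed (V : lmodType R) (H : set V) (nrm : V -> R)
    (a : V -> V -> R) (data : set (V -> R)) : Prop :=
  exists c : R, forall g, data g ->
    exists2 x,
      unique (fun x => H x /\ forall y, H y -> a x y = g y) x &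
      nrm x <= c * dual_norm H nrm g.

Definition split_data (S O : set 'rV[R]_3) (m : tetmesh R) (k : nat)
    : set (fields m -> R) :=
  [set g | exists (gB gE : vfield m -> R) (gp : sfield m -> R),
     [/\ functional_on (Hhimp_div S O k) gB,
         functional_on (Hhimp_curl S O k) gE,
         functional_on (Hh0_grad S O k) gp &
         g = fun y => gB y.1.1 + gE y.1.2 + gp y.2]].

End WellPosedness.

Arguments split_data {R} S O m k _.

(* Main.v *)
Require Import Defs.
From HB Require Import structures.
From mathcomp Require Import all_boot all_order all_algebra.
From mathcomp Require Import mpoly.
From mathcomp Require Import all_classical all_reals all_analysis.
From mathcomp Require Import measurable_realfun.
From mathcomp Require Import ring lra.

Set Implicit Arguments.
Unset Strict Implicit.
Unset Printing Implicit Defensive.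

Import Order.TTheory GRing.Theory Num.Theory numFieldNormedType.Exports.

Local Open Scope classical_set_scope.
Local Open Scope ring_scope.

(* For (B, E, p) in V_h one tests with
     (C, F, q) = (B + tau/2 curl E, E + tau/2 grad p, p),
   which lies in V_h since curl and grad map the finite element spaces into one
   another. As div curl = 0, curl grad = 0 and grad p has no tangential trace on
   Gamma_i, the form dominates half of the squared norm of (B, E, p) after
   completing squares, while the norm of the test function is at most twice that
   of (B, E, p); this gives the constant 1/4. Boundedness with C_0 = 9 is
   Cauchy-Schwarz applied to each of the nine terms. V_h embeds linearly into a
   finite dimensional space of coefficients, so injectivity yields existence, and
   the bound on the solution is the inf-sup condition again. Injectivity requires
   the squared norm to be definite: a polynomial with vanishing weighted L^2 norm
   on a tetrahedron vanishes on its interior, which is nonempty. *)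

(** Testing with (B, E, p) itself cancels the skew terms and leaves the curl and gradient parts of
    the norm uncontrolled; the added multiples of curl E and grad p recover exactly these parts. As
    2/tau and tau/2 are inverse to each other, each surviving cross term has coefficient 1 and is
    absorbed by half of two squares, whatever tau is; eps and mu enter only as weights of positive
    semidefinite forms. The estimates are therefore pure algebra, carried out for abstract forms and
    two numbers with s t = 1. The other difficulty is that fields are bare families of polynomials
    on cells, without weak derivatives: that grad and curl preserve the interface and boundary
    conditions must be read off from traces on triangles. A polynomial vanishing on a triangle has
    zero tangential derivatives there, and the tangential part of a gradient and the normal part of
    a curl involve only such derivatives of the relevant traces. *)

(** * Integrals of continuous functions *)

Section IntegralContinuous.

Context d (T : measurableType d) (R : realType) (n : nat).
Variables (h : T -> 'rV[R]_n).
Hypothesis mh : forall i, measurable_fun setT (fun t => h t 0 i).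

(** Integrals run over products of copies of R while integrands live on row vectors, so
    measurability is pulled back along [h], from its coordinates. A sup-norm ball is a finite
    intersection of conditions on coordinates. *)
Lemma measurable_preimage_ball (x : 'rV[R]_n) (r : R) :
  measurable (h @^-1` ball x r).
Proof.
have [r0|r0] := leP r 0.
  rewrite (_ : _ @^-1` _ = set0) //; apply/seteqP; split=> t //= [] .
  by rewrite ltNge r0.
rewrite (_ : _ @^-1` _ =
  \bigcap_(i in [set: 'I_n]) (fun t => h t 0 i) @^-1` ball (x 0 i) r).
  apply: fin_bigcap_measurable => // i _; rewrite -[X in measurable X]setTI.
  by apply: mh => //; exact: measurable_ball.
apply/seteqP; split=> t /=.
  by case=> _ xh i _; apply: xh.
by move=> xh; split=> // i j; rewrite (ord1 i); exact: xh.
Qed.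

(* An open set is the union of the rational balls it contains. *)
Lemma measurable_preimage_open (U : set 'rV[R]_n) :
  open U -> measurable (h @^-1` U).
Proof.
move=> oU.
pose B (q : {ffun 'I_n -> rat} * rat) : set 'rV[R]_n :=
  ball (\row_i ratr (q.1 i) : 'rV[R]_n) (ratr q.2).
pose F q := [set t | B q `<=` U /\ B q (h t)].
rewrite (_ : _ @^-1` _ = \bigcup_q F q).
  apply: countable_bigcupT_measurable => // q.
  have [BU|nBU] := pselect (B q `<=` U).
    rewrite (_ : F q = h @^-1` B q); first exact: measurable_preimage_ball.
    by apply/seteqP; split=> t //= [].
  by rewrite (_ : F q = set0) //; apply/seteqP; split=> t //= [].
apply/seteqP; split=> t /=; last by move=> [q _ [BU Bt]]; exact: BU.
move=> Ut; have /nbhs_ballP[e /= e0 eU] : nbhs (h t) U by exact: open_nbhs_nbhs.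
(* The rational centre will be within [r] of [h t], so the ball of radius [r] around it stays within
   2 r < e of [h t]. *)
have /rat_in_itvoo[r rI] : 0 < e / 2 by rewrite divr_gt0.
have {rI}[r0 re] : (0 < ratr r :> R) /\ ratr r < e / 2.
  by move: rI; rewrite in_itv /= => /andP.
have /boolp.choice[q qP] : forall i, exists s : rat, `|h t 0 i - ratr s| < ratr r.
  move=> i.
  have /rat_in_itvoo[s] : h t 0 i - ratr r < h t 0 i + ratr r.
    by rewrite ltrBlDr -addrA ltrDl addr_gt0.
  rewrite in_itv /= => sI; exists s.
  by rewrite distrC ltr_distl.
have Bt : B ([ffun i => q i], r) (h t).
  split=> //= i j; rewrite /ball /= !mxE ffunE /= (ord1 i) distrC; exact: qP.
exists ([ffun i => q i], r) => //; split=> // y [_ /= By].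
apply: eU; split=> // i j; rewrite (ord1 i).
have := By 0 j; have := qP j; rewrite /ball /= !mxE ffunE /= => h1 h2.
rewrite (splitr e) -(subrKA (ratr (q j))).
by rewrite (le_lt_trans (ler_normD _ _))// ltrD// (lt_trans _ re).
Qed.

Lemma measurable_preimage_closed (A : set 'rV[R]_n) :
  closed A -> measurable (h @^-1` A).
Proof.
move=> cA; rewrite -[X in measurable X]setCK.
apply: measurableC; apply: (@measurable_preimage_open (~` A)).
exact: closed_openC.
Qed.

(** The weights are continuous only on the closure of the domain, so the preimage of an interval is
    open only relative to [A]: it is an open [V] cut by [A]. *)
Lemma measurable_comp_within (A : set 'rV[R]_n) (f : 'rV[R]_n -> R) :
  closed A -> {within A, continuous f} ->
  measurable_fun (h @^-1` A) (f \o h).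
Proof.
move=> cA /continuousP cf; have mA := measurable_preimage_closed cA.
apply: (measurability _ (RGenOpens.measurableE R)).
move=> _ [_ [a [b ->] <-]].
have /cf/open_subspaceP[V oV VA] := @itv_open _ R a b.
rewrite (_ : _ `&` _ = h @^-1` (V `&` A)).
  by apply: (measurableI (h @^-1` V)) => //; exact: measurable_preimage_open.
by rewrite VA; apply/seteqP; split=> t /= [].
Qed.

Lemma integrable_comp_within (mu : {measure set T -> \bar R}) (D : set T)
    (A : set 'rV[R]_n) (f : 'rV[R]_n -> R) :
  measurable D -> (mu D < +oo)%E -> compact A -> D `<=` h @^-1` A ->
  {within A, continuous f} -> mu.-integrable D (EFin \o (f \o h)).
Proof.
move=> mD Dfin cA DA cf; apply: measurable_bounded_integrable => //.
  have clA : closed A by apply: compact_closed => //; exact: norm_hausdorff.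
  apply: (measurable_funS _ DA); first exact: measurable_preimage_closed.
  exact: measurable_comp_within.
have [M [Mr bM]] : bounded_set (f @` A).
  by apply/compact_bounded/continuous_compact.
exists M; split=> // x Mx t Dt /=; apply: (bM _ Mx); exists (h t) => //.
exact: DA.
Qed.

End IntegralContinuous.

(** * Integrals over compact subsets of space *)

Section VolumeIntegral.

Variable R : realType.

Local Notation vol := ((@lebesgue_measure R \x @lebesgue_measure R)
              \x @lebesgue_measure R)%E.

Local Notation R3 := (measurableTypeR R * measurableTypeR R * measurableTypeR R)%type.

Lemma measurable_point3 i :
  measurable_fun [set: R3] (fun t => @point3 R t 0 i).
Proof.
case: i => [[|[|[|//]]] ?]; under eq_fun do rewrite mxE /=.
- exact: measurableT_comp measurable_fst measurable_fst.
- exact: measurableT_comp measurable_snd measurable_fst.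
- exact: measurable_snd.
Qed.

(** Sup-norm balls are cubes, so their volume is a product of lengths. *)
Lemma point3_preimage_ball (x : 'rV[R]_3) (r : R) : 0 < r ->
  @point3 R @^-1` ball x r =
  (ball (x 0 0) r `*` ball (x 0 (inord 1)) r) `*` ball (x 0 (inord 2)) r.
Proof.
move=> r0; apply/seteqP; split=> t /=.
  case=> _ xt; have := (xt 0 0, xt 0 (inord 1), xt 0 (inord 2)).
  by rewrite !mxE !inordK //= => -[[]].
move=> [[/= t0 t1] t2]; split=> // i j; rewrite (ord1 i) mxE.
case: j => [[|[|[|//]]] lej] /=.
- by rewrite (_ : Ordinal _ = 0) //; exact/val_inj.
- by rewrite (_ : Ordinal _ = inord 1) //; apply/val_inj; rewrite /= inordK.
- by rewrite (_ : Ordinal _ = inord 2) //; apply/val_inj; rewrite /= inordK.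
Qed.

Lemma volume_ball (x : 'rV[R]_3) (r : R) : 0 < r ->
  vol (@point3 R @^-1` ball x r) = ((r *+ 2) * (r *+ 2) * (r *+ 2))%:E.
Proof.
move=> r0; rewrite point3_preimage_ball // product_measure1E //=; first last.
- exact: measurable_ball.
- by apply: measurableX; exact: measurable_ball.
rewrite product_measure1E; try exact: measurable_ball.
have mB y : lebesgue_measure (ball y r) = (r *+ 2)%:E.
  by rewrite lebesgue_measure_ball // ltW.
by rewrite 2!EFinM; congr (_ * _ * _)%E; exact: mB.
Qed.

Lemma volume_bounded (A : set 'rV[R]_3) : closed A -> bounded_set A ->
  (vol (@point3 R @^-1` A) < +oo)%E.
Proof.
move=> cA [M [_ bA]]; have mA := measurable_preimage_closed measurable_point3 cA.
(* One unit reaches a level strictly above [M], where the bound on [A] holds; the second one puts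
   [A] inside an open ball. *)
have r0 : 0 < `|M| + 2 :> R by rewrite ltr_wpDl.
apply: (@le_lt_trans _ _ (vol (@point3 R @^-1` ball 0 (`|M| + 2)))).
  apply: le_measure; rewrite ?inE //.
    exact: measurable_preimage_ball measurable_point3 _ _.
  move=> t At /=; rewrite mx_norm_ball /ball_ /= sub0r normrN.
  apply: (@le_lt_trans _ _ (`|M| + 1)); last by rewrite ltrD2l ltr1n.
  by apply: (bA (`|M| + 1)) => //; rewrite (le_lt_trans (ler_norm _)) // ltrDl.
by rewrite volume_ball // ltry.
Qed.

Variables (A : set 'rV[R]_3) (cA : compact A).

Let clA : closed A. Proof. by apply: compact_closed => //; exact: norm_hausdorff. Qed.

Let mA : measurable (@point3 R @^-1` A).
Proof. exact: (measurable_preimage_closed measurable_point3 clA). Qed.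

Lemma integrable_vol (f : 'rV[R]_3 -> R) : {within A, continuous f} ->
  vol.-integrable (@point3 R @^-1` A) (EFin \o (f \o @point3 R)).
Proof.
move=> cf; apply: (integrable_comp_within measurable_point3 mA _ cA) => //.
by apply: volume_bounded => //; exact: compact_bounded.
Qed.

Lemma vol_int_linear (a : R) (f g : 'rV[R]_3 -> R) :
  {within A, continuous f} -> {within A, continuous g} ->
  vol_int A (fun x => a * f x + g x) = a * vol_int A f + vol_int A g.
Proof.
move=> cf cg; have [If Ig] := (integrable_vol cf, integrable_vol cg).
rewrite /vol_int RintegralD //; first by rewrite RintegralZl.
by rewrite (_ : _ \o _ = fun t => a%:E * (f (point3 t))%:E)%E //; exact: integrableZl.
Qed.

Lemma vol_int_ge0 (f : 'rV[R]_3 -> R) : (forall x, A x -> 0 <= f x) ->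
  0 <= vol_int A f.
Proof. by move=> f0; apply: Rintegral_ge0 => t; exact: f0. Qed.

(** If [f x] were positive, [f] would exceed [f x / 2] on a cube around [x], which has positive
    volume. Openness of [U] turns continuity within [A] into continuity at [x]. *)
Lemma vol_int_eq0 (f : 'rV[R]_3 -> R) (U : set 'rV[R]_3) :
  {within A, continuous f} -> (forall x, A x -> 0 <= f x) ->
  vol_int A f = 0 -> open U -> U `<=` A -> forall x, U x -> f x = 0.
Proof.
move=> cf f0 int0 oU UA x Ux; apply/eqP; rewrite eq_le f0 ?andbT; last exact: UA.
rewrite leNgt; apply/negP => fx0.
have /nbhs_ballP[r /= r0 rB] : nbhs x [set y | U y /\ f x / 2 < f y].
  have cfU : {within U, continuous f} by exact: continuous_subspaceW cf.
  have cfx : {for x, continuous f}.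
    by rewrite continuous_open_subspace // in cfU; apply: cfU; rewrite inE.
  apply: filterI; first exact: open_nbhs_nbhs.
  apply: (cfx [set z | f x / 2 < z]); apply: open_nbhs_nbhs; split.
    exact: open_gt.
  by rewrite /= ltr_pdivrMr // ltr_pMr // ltr1n.
have mB : measurable (@point3 R @^-1` ball x r).
  exact: measurable_preimage_ball measurable_point3 _ _.
have If := integrable_vol cf; have [mf _] := (integrableP _ _ _ If).
have BA : @point3 R @^-1` ball x r `<=` @point3 R @^-1` A.
  by move=> t /rB[/UA].
(* [vol_int] is [fine] of an extended integral, and [fine] sends infinities to 0; integrability
   excludes this case. *)
have int0' : (\int[vol]_(t in @point3 R @^-1` A) (f (point3 t))%:E = 0)%E.
  by rewrite -[LHS]fineK ?[fine _]int0 //; exact: integrable_fin_num.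
have : (\int[vol]_(t in @point3 R @^-1` ball x r) (cst (f x / 2)%:E) t <= 0)%E.
  rewrite -int0'.
  apply: (@le_trans _ _
    (\int[vol]_(t in @point3 R @^-1` ball x r) (f (point3 t))%:E)%E).
    apply: ge0_le_integral => //.
    - by move=> t _; rewrite lee_fin divr_ge0 // ltW.
    - exact: (measurable_funS mA BA mf).
    - by move=> t /rB[_ /ltW]; rewrite lee_fin.
  by apply: ge0_subset_integral => // t At; rewrite lee_fin f0.
rewrite integral_cst // [X in (_ * X)%E](_ : _ = (r *+ 2 * (r *+ 2) * (r *+ 2))%:E);
  last exact: volume_ball.
rewrite -EFinM lee_fin leNgt => /negP; apply.
by rewrite !mulr_gt0 ?invr_gt0 ?mulrn_wgt0.
Qed.

End VolumeIntegral.

(** * Integrals over triangles *)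

Section SurfaceIntegral.

Variable R : realType.
Variables a b c : 'rV[R]_3.

Local Notation R2 := (measurableTypeR R * measurableTypeR R)%type.
Local Notation area := (@lebesgue_measure R \x @lebesgue_measure R)%E.

Let D : set R2 :=
  [set s : R2 | [/\ 0 <= s.1 :> R, 0 <= s.2 :> R & s.1 + s.2 <= 1 :> R]].

Let h (s : R2) : 'rV[R]_3 := a + (s.1 : R) *: (b - a) + (s.2 : R) *: (c - a).

Let mh i : measurable_fun [set: R2] (fun s => h s 0 i).
Proof.
under eq_fun do rewrite !mxE.
apply: measurable_funD; first apply: measurable_funD => //.
  by apply: measurable_funM => //; exact: measurable_fst.
by apply: measurable_funM => //; exact: measurable_snd.
Qed.

Let mD : measurable D.
Proof.
have m12 : measurable_fun [set: R2] (fun s : R2 => (s.1 : R) + s.2).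
  by apply: measurable_funD; [exact: measurable_fst|exact: measurable_snd].
rewrite (_ : D = (fst @^-1` `[0, +oo[ `&` snd @^-1` `[0, +oo[) `&`
    (fun s : R2 => (s.1 : R) + s.2) @^-1` `]-oo, 1]).
  apply: measurableI; first apply: measurableI.
  - rewrite -[X in measurable X]setTI.
    by apply: measurable_fst => //; exact: measurable_itv.
  - rewrite -[X in measurable X]setTI.
    by apply: measurable_snd => //; exact: measurable_itv.
  - by rewrite -[X in measurable X]setTI; apply: m12 => //; exact: measurable_itv.
by apply/seteqP; split=> s; rewrite /D /= !in_itv /= !andbT; [case|move=> [[]]].
Qed.

Let D_unit : D `<=` `[0, 1] `*` `[0, 1].
Proof. by move=> s [s0 s1 s2] /=; rewrite !in_itv /=; lra. Qed.

Let D_fin : (area D < +oo)%E.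
Proof.
pose I : set (measurableTypeR R) := `[0, 1]%classic.
have mI : measurable I by exact: measurable_itv.
apply: (@le_lt_trans _ _ (area (I `*` I))).
  apply: le_measure; rewrite ?inE //.
  exact: measurableX.
rewrite product_measure1E //.
have I1 : lebesgue_measure I = 1%:E.
  by rewrite /I lebesgue_measure_itv /= lte_fin ltr01 oppr0 adde0.
rewrite [X in (X < _)%E](_ : _ = 1%:E) ?ltry //.
have /= := congr2 (fun x y => x * y)%E I1 I1.
by rewrite mule1.
Qed.

Lemma integrable_tri (f : 'rV[R]_3 -> R) : continuous f ->
  area.-integrable D (EFin \o (f \o h)).
Proof.
(* Both parameters lie between 0 and 1, so the triangle is contained in the closed ball of radius
   [M], which is compact. *)
move=> cf; pose M := `|a| + `|b - a| + `|c - a|.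
apply: (@integrable_comp_within _ _ _ _ h mh area D [set x | `|x| <= M]) => //.
- apply: bounded_closed_compact.
    exists M; split=> [|y My x /= xM]; [exact: num_real|]; exact: le_trans xM (ltW My).
apply: (@preimage_closed _ _ (fun x : 'rV[R]_3 => `|x|) [set y | y <= M]).
    by move=> x _; exact: norm_continuous.
  exact: closed_le.
- move=> s [s0 s1 s2] /=; rewrite /h /M.
  rewrite (le_trans (ler_normD _ _)) // lerD //.
    rewrite (le_trans (ler_normD _ _)) // lerD // normrZ ger0_norm //.
    by rewrite ler_piMl //; lra.
  by rewrite normrZ ger0_norm // ler_piMl //; lra.
- exact: continuous_subspaceT.
Qed.

Lemma tri_int_linear (k : R) (f g : 'rV[R]_3 -> R) :
  continuous f -> continuous g ->
  tri_int a b c (fun x => k * f x + g x) = k * tri_int a b c f + tri_int a b c g.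
Proof.
move=> cf cg; have [If Ig] := (integrable_tri cf, integrable_tri cg).
rewrite /tri_int mulrCA -mulrDr; congr (_ * _).
rewrite RintegralD //; first by rewrite RintegralZl.
by rewrite (_ : _ \o _ = fun s => k%:E * (f (h s))%:E)%E //; exact: integrableZl.
Qed.

Lemma tri_int_ge0 (f : 'rV[R]_3 -> R) : (forall x, 0 <= f x) ->
  0 <= tri_int a b c f.
Proof.
by move=> f0; apply: mulr_ge0; [exact: sqrtr_ge0|apply: Rintegral_ge0 => s _].
Qed.

End SurfaceIntegral.

(** * Polynomials vanishing on lines, triangles and open sets *)

Section PolynomialsOnLines.

Variables (R : realType) (n : nat).
Implicit Types (p q : {mpoly R[n]}) (x t : 'rV[R]_n).

(** Restricting [p] to a line reduces questions about its zeros to counting roots in one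
    variable. *)
Definition line_poly x t p : {poly R} :=
  mmap (@polyC R) (fun i => (x 0 i)%:P + t 0 i *: 'X) p.

Lemma line_polyE x t p s : (line_poly x t p).[s] = p.@[(x + s *: t) 0].
Proof.
rewrite /line_poly /mmap horner_sum mevalE; apply: eq_bigr => m _.
rewrite hornerM hornerC /mmap1 horner_prod; congr (_ * _).
by apply: eq_bigr => i _; rewrite horner_exp !hornerE !mxE mulrC.
Qed.

Lemma line_polyM x t p q : line_poly x t (p * q) = line_poly x t p * line_poly x t q.
Proof. exact: (mmap_is_multiplicative _ _).1. Qed.

(** Chain rule: the identity passes to sums and products and holds for constants and variables,
    hence for every polynomial. *)
Lemma deriv_line_poly x t p :
  (line_poly x t p)^`() = \sum_i t 0 i *: line_poly x t p^`M(i).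
Proof.
pose P p := (line_poly x t p)^`() = \sum_i t 0 i *: line_poly x t p^`M(i).
have PD q r : P q -> P r -> P (q + r).
  rewrite /P /line_poly => Pq Pr; rewrite mmapD derivD Pq Pr -big_split /=.
  by apply: eq_bigr => i _; rewrite mderivD mmapD scalerDr.
have PC c : P c%:MP.
  rewrite /P /line_poly mmapC derivC big1 // => i _.
  by rewrite mderivC mmap0 scaler0.
have PM q r : P q -> P r -> P (q * r).
  rewrite /P => Pq Pr; rewrite line_polyM derivM Pq Pr mulr_suml mulr_sumr.
  rewrite -big_split /=; apply: eq_bigr => i _.
  rewrite mderivM /line_poly mmapD -!/(line_poly _ _ _) !line_polyM scalerDr.
  by rewrite scalerAl scalerAr.
have PX i : P 'X_i.
  rewrite /P /line_poly mmapX mmap1U derivD derivC derivZ derivX add0r.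
  rewrite (bigD1 i) //= big1 ?addr0 => [|j ji]; rewrite mderivX mnm1E.
    have -> : (U_(i) - U_(i) = 0 :> 'X_{1..n})%MM.
      by apply/mnmP => k; rewrite mnmBE subnn mnm0E.
    by rewrite eqxx scale1r mmapX mmap11.
  by rewrite eq_sym (negbTE ji) scale0r mmap0 scaler0.
suff: P p by [].
rewrite [p]mpolyE; elim/big_ind: _ => [|q r|m _]; [by rewrite -mpolyC0|exact: PD|].
rewrite -mul_mpolyC; apply: (PM) => //; rewrite mpolyXE_id.
elim/big_ind: _ => [|q r|i _]; [by rewrite -mpolyC1|exact: PM|].
elim: (m i) => [|k IH]; first by rewrite expr0 -mpolyC1.
by rewrite exprS; exact: PM.
Qed.

Lemma poly_eq0_itv (q : {poly R}) (a b : R) : a < b ->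
  (forall s, a < s < b -> q.[s] = 0) -> q = 0.
Proof.
move=> ab q0; apply/eqP; apply: contraT => qn0.
(* Infinitely many distinct points; the denominators start at 2 to stay strictly below [b]. *)
pose s (i : nat) := a + (b - a) / i.+2%:R.
have sI i : a < s i < b.
  have ba : 0 < b - a by rewrite subr_gt0.
  rewrite /s ltrDl divr_gt0 //= -ltrBrDl ltr_pdivrMr //.
  by rewrite ltr_pMr // ltr1n.
have : (size (mkseq s (size q)) < size q)%N.
  apply: max_poly_roots => //.
    by apply/allP => _ /mapP[i _ ->]; apply/eqP/q0.
  rewrite map_inj_uniq ?iota_uniq // => i j /addrI.
  move/(mulfI _); rewrite subr_eq0 (gt_eqF ab) => /(_ isT)/invr_inj/eqP.
  by rewrite eqr_nat => /eqP[].
by rewrite size_mkseq ltnn.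
Qed.

Lemma line_poly_deriv0 x t p : line_poly x t p = 0 ->
  \sum_i t 0 i * (p^`M(i)).@[x 0] = 0.
Proof.
move=> p0; have := deriv_line_poly x t p; rewrite p0 linear0 => /esym.
move=> /(congr1 (fun q : {poly R} => q.[0])); rewrite horner0 horner_sum => h.
rewrite -[RHS]h.
by apply: eq_bigr => i _; rewrite hornerZ line_polyE scale0r addr0.
Qed.

Lemma msize_mderiv p i : (msize p^`M(i) <= (msize p).-1)%N.
Proof.
have [->|pn0] := eqVneq p 0; first by rewrite mderiv0 msize0.
rewrite msizeE; apply/bigmax_leqP_seq => m; rewrite mcoeff_msupp.
rewrite mcoeff_mderiv => pm _; rewrite -ltnS -(mpolySpred mdeg pn0).
have: p@_(m + U_(i)) != 0 by apply: contraNneq pm => ->; rewrite mul0rn.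
by rewrite -mcoeff_msupp => /msize_mdeg_lt; rewrite mdegD mdeg1 addn1.
Qed.

(** Induction on the size: restriction to lines parallel to the axes shows that the partial
    derivatives vanish everywhere too, so they are zero and [p] is constant. *)
Lemma mpoly_eq0_everywhere p : (forall x, p.@[x 0] = 0) -> p = 0.
Proof.
have [k] := ubnP (msize p); elim: k p => // k IH p; rewrite ltnS => pk p0.
have dp0 i : p^`M(i) = 0.
  have [->|pn0] := eqVneq p 0; first by rewrite mderiv0.
  apply: IH => [|x].
    apply: leq_ltn_trans (msize_mderiv _ _) _.
    by rewrite -(mpolySpred mdeg pn0).
  have: line_poly x (delta_mx 0 i) p = 0.
    apply: (@poly_eq0_itv _ 0 1) => // s _; rewrite line_polyE; exact: p0.
  move/line_poly_deriv0; rewrite (bigD1 i) //= big1 ?addr0.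
    by rewrite mxE !eqxx mul1r.
  by move=> j ji; rewrite mxE (negbTE ji) andbF mul0r.
suff pC : p = (p@_0%MM)%:MP.
  by have := p0 0; rewrite pC mevalC => ->; rewrite mpolyC0.
apply/mpolyP => m; rewrite mcoeffC.
have [->|m0] := eqVneq m 0%MM; first by rewrite mulr1.
rewrite mulr0; have: [exists i, m i != 0%N].
  apply: contraR m0; rewrite negb_exists => /forallP m0.
  by apply/eqP/mnmP => i; rewrite mnm0E; apply/eqP; move: (m0 i); rewrite negbK.
(* This coefficient of the derivative is that of [p] at [m] times the exponent [m i], which is
   nonzero. *)
case/existsP => i mi; have := congr1 (mcoeff (m - U_(i))%MM) (dp0 i).
rewrite mcoeff0 mcoeff_mderiv submK; last by rewrite lep1mP.
by move/eqP; rewrite mulrn_eq0 => /eqP.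
Qed.

(** Every [y] lies on a line through a fixed point of [U], and [p] has an interval of zeros on that
    line. *)
Lemma mpoly_eq0_open (U : set 'rV[R]_n) p : open U -> U !=set0 ->
  (forall x, U x -> p.@[x 0] = 0) -> p = 0.
Proof.
move=> oU [x Ux] p0; apply: mpoly_eq0_everywhere => y.
suff l0 : line_poly x (y - x) p = 0.
  by have := line_polyE x (y - x) p 1; rewrite l0 horner0 scale1r addrC subrK.
have : \forall s \near (0 : R), U (x + s *: (y - x)).
  have ct : {for 0, continuous (fun s : R => x + s *: (y - x))}.
    by apply: cvgD; [exact: cvg_cst|exact: scalel_continuous].
  apply: (ct U); rewrite scale0r addr0; exact: open_nbhs_nbhs.
move=> /nbhs_ballP[e /= e0 eU]; apply: (@poly_eq0_itv _ 0 e) => // s /andP[s0 se].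
rewrite line_polyE; apply: p0; apply: eU.
by rewrite /ball /= sub0r normrN gtr0_norm.
Qed.

Lemma continuous_meval p : continuous (fun x : 'rV[R]_n => p.@[x 0]).
Proof.
under eq_fun do rewrite mevalE.
apply: continuous_big => [|m _]; first exact: add_continuous.
move=> x; apply: (@continuous_comp _ _ _ (fun x : 'rV[R]_n => \prod_i x 0 i ^+ m i)
  ( *%R p@_m)); last exact: mulrl_continuous.
move: x; apply: continuous_big => [|i _ x]; first exact: mul_continuous.
apply: (@continuous_comp _ _ _ (fun x : 'rV[R]_n => x 0 i) (fun y => y ^+ m i)).
  exact: coord_continuous.
exact: exprn_continuous.
Qed.


End PolynomialsOnLines.

(** * Vector identities and traces on triangles *)

Section Vectors3.

Lemma sum_ord3 (V : nmodType) (F : 'I_3 -> V) : \sum_i F i = F 0 + F 1 + F (-1).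
Proof.
rewrite !big_ord_recl big_ord0 addr0 addrA.
by congr (F _ + F _ + F _); exact/val_inj.
Qed.

Lemma ord3_ind (P : 'I_3 -> Prop) : P 0 -> P 1 -> P (-1) -> forall i, P i.
Proof.
move=> P0 P1 P2 [[|[|[|//]]] lti].
- by rewrite (_ : Ordinal _ = 0) //; exact/val_inj.
- by rewrite (_ : Ordinal _ = 1) //; exact/val_inj.
- by rewrite (_ : Ordinal _ = -1) //; exact/val_inj.
Qed.

Let ord3D : ((0 : 'I_3) + 1 = 1) * ((1 : 'I_3) + 1 = -1) * ((-1 : 'I_3) + 1 = 0).
Proof. by do ![split]; exact/val_inj. Qed.

Let ord3B : ((0 : 'I_3) - 1 = -1) * ((1 : 'I_3) - 1 = 0) * ((-1 : 'I_3) - 1 = 1).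
Proof. by do ![split]; exact/val_inj. Qed.

Definition ord3E := (ord3D, ord3B).

Variable R : realType.
Implicit Types u v w n t : 'rV[R]_3.

Lemma dotE u v : dot u v = u 0 0 * v 0 0 + u 0 1 * v 0 1 + u 0 (-1) * v 0 (-1).
Proof. exact: sum_ord3. Qed.

Lemma vprodE u v : (vprod u v 0 0 = u 0 1 * v 0 (-1) - u 0 (-1) * v 0 1) *
  (vprod u v 0 1 = u 0 (-1) * v 0 0 - u 0 0 * v 0 (-1)) *
  (vprod u v 0 (-1) = u 0 0 * v 0 1 - u 0 1 * v 0 0).
Proof. by rewrite !mxE /cross !ord3E. Qed.

Lemma row3P u v : u 0 0 = v 0 0 -> u 0 1 = v 0 1 -> u 0 (-1) = v 0 (-1) -> u = v.
Proof. by move=> e0 e1 e2; apply/rowP; apply: ord3_ind. Qed.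

Lemma dotC u v : dot u v = dot v u.
Proof. by apply: eq_bigr => i _; rewrite mulrC. Qed.

Lemma dotDl u v w : dot (u + v) w = dot u w + dot v w.
Proof. by rewrite !dotE !mxE; ring. Qed.

Lemma dotZl (a : R) u v : dot (a *: u) v = a * dot u v.
Proof. by rewrite !dotE !mxE; ring. Qed.

Lemma dot_ge0 u : 0 <= dot u u.
Proof. by apply: sumr_ge0 => i _; rewrite -expr2 sqr_ge0. Qed.

Lemma dot_eq0 u : dot u u = 0 -> u = 0.
Proof.
move/eqP; rewrite psumr_eq0 => [/allP u0|i _]; last by rewrite -expr2 sqr_ge0.
apply/rowP => i; rewrite mxE; apply/eqP.
by have := u0 i (mem_index_enum _); rewrite /= mulf_eq0 orbb.
Qed.

Lemma vprodDl u v w : vprod (u + v) w = vprod u w + vprod v w.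
Proof. by apply: row3P; rewrite !mxE /cross !mxE; ring. Qed.

Lemma vprodZl (a : R) u v : vprod (a *: u) v = a *: vprod u v.
Proof. by apply: row3P; rewrite !mxE /cross !mxE; ring. Qed.

Lemma vprod0l n : vprod 0 n = 0.
Proof. by apply: row3P; rewrite !mxE /cross !mxE; ring. Qed.

(** Expansion of the triple product: u x (t1 x t2) = (u . t2) t1 - (u . t1) t2. *)
Lemma vprod_normal u t1 t2 (s : R) : dot t1 u = 0 -> dot t2 u = 0 ->
  vprod u (s *: vprod t1 t2) = 0.
Proof.
have E : vprod u (s *: vprod t1 t2) = (s * dot t2 u) *: t1 - (s * dot t1 u) *: t2.
  by apply: row3P; rewrite !vprodE !mxE /cross !ord3E !dotE; ring.
by move=> h1 h2; rewrite E h1 h2 mulr0 !scale0r subr0.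
Qed.

(** For a unit normal the tangential part of u is - (u x n) x n. *)
Lemma tang_normal n u : vprod u n = 0 -> dot n n = 1 -> tang n u = 0.
Proof.
move=> un n1.
have E : dot n n *: u - dot u n *: n = - vprod (vprod u n) n.
  by apply: row3P; rewrite !mxE /cross !ord3E !mxE /cross !ord3E !dotE; ring.
have : dot n n *: u - dot u n *: n = 0.
  by rewrite E un vprod0l oppr0.
by rewrite n1 scale1r.
Qed.

(** Binet-Cauchy identity for d x n and t x n. *)
Lemma dot_parallel d n t : vprod d n = 0 -> dot n t = 0 -> dot n n * dot d t = 0.
Proof.
move=> dn nt.
have E : dot n n * dot d t = dot (vprod d n) (vprod t n) + dot d n * dot n t.
  by rewrite !dotE !vprodE; ring.
by rewrite E dn nt mulr0 addr0 /dot big1 // => i _; rewrite mxE mul0r.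
Qed.

Definition tri_set (a t1 t2 : 'rV[R]_3) : set 'rV[R]_3 :=
  [set y | exists s r : R, [/\ 0 <= s, 0 <= r, s + r <= 1 & y = a + s *: t1 + r *: t2]].

(** Zeros spread from the triangle to whole lines parallel to [t1], then along [t2] to its whole
    plane. *)
Lemma line_poly_tri0 a t1 t2 (p : {mpoly R[3]}) :
  (forall y, tri_set a t1 t2 y -> p.@[y 0] = 0) ->
  forall s r, line_poly (a + s *: t1 + r *: t2) t2 p = 0.
Proof.
move=> p0.
have l1 r s : 0 < r < 1 -> p.@[(a + s *: t1 + r *: t2) 0] = 0.
  move=> /andP[r0 r1].
  have l0 : line_poly (a + r *: t2) t1 p = 0.
    apply: (@poly_eq0_itv _ _ 0 (1 - r)); first by rewrite subr_gt0.
    move=> {}s /andP[s0 s1]; rewrite line_polyE addrAC; apply: p0.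
    by exists s, r; split=> //; lra.
  by have := line_polyE (a + r *: t2) t1 p s; rewrite l0 horner0 addrAC.
have l2 s : line_poly (a + s *: t1) t2 p = 0.
  by apply: (@poly_eq0_itv _ _ 0 1) => // r r01; rewrite line_polyE l1.
move=> s r; apply: (@poly_eq0_itv _ _ 0 1) => // q _.
rewrite line_polyE -addrA -scalerDl.
by have := line_polyE (a + s *: t1) t2 p (r + q); rewrite l2 horner0.
Qed.

Lemma tri_set_sym a t1 t2 : tri_set a t1 t2 = tri_set a t2 t1.
Proof.
by apply/seteqP; split=> y [s [r [s0 r0 sr ->]]]; exists r, s;
  rewrite addrAC [r + s]addrC.
Qed.

(** As [p] vanishes on the whole plane, points on the edges of the triangle are treated like
    interior ones. *)
Lemma tri_tangential_deriv0 a t1 t2 (p : {mpoly R[3]}) x :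
  (forall y, tri_set a t1 t2 y -> p.@[y 0] = 0) -> tri_set a t1 t2 x ->
  dot t1 (veval (pgrad p) x) = 0 /\ dot t2 (veval (pgrad p) x) = 0.
Proof.
move=> p0 [s [r [_ _ _ ->]]].
have dE t y : dot t (veval (pgrad p) y) = \sum_i t 0 i * (p^`M(i)).@[y 0].
  by apply: eq_bigr => i _; rewrite mxE ffunE.
rewrite !dE; split; apply: line_poly_deriv0; last exact: line_poly_tri0.
rewrite addrAC; apply: (@line_poly_tri0 _ t2) => y; rewrite tri_set_sym.
exact: p0.
Qed.

Lemma pgrad_normal a t1 t2 (p : {mpoly R[3]}) x (c : R) :
  (forall y, tri_set a t1 t2 y -> seval p y = 0) -> tri_set a t1 t2 x ->
  vprod (veval (pgrad p) x) (c *: vprod t1 t2) = 0.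
Proof. by move=> p0 /(tri_tangential_deriv0 p0)[h1 h2]; exact: vprod_normal. Qed.

(** The normal component of a curl combines tangential derivatives of the tangential trace: a
    pointwise form of Stokes' theorem. *)
Lemma pcurl_normal a t1 t2 (w : vpoly R) x (c : R) N :
  N = c *: vprod t1 t2 ->
  (forall y, tri_set a t1 t2 y -> vprod (veval w y) N = 0) ->
  tri_set a t1 t2 x -> dot (veval (pcurl w) x) N = 0.
Proof.
move=> NE w0 Tx.
(* Component [i] of w x N as a polynomial. It vanishes on the triangle, hence so do its derivatives
   along [t1] and [t2], which are the components of D t x N. *)
pose g i := N 0 (i - 1) *: w (i + 1) - N 0 (i + 1) *: w (i - 1).
have g0 i y : tri_set a t1 t2 y -> (g i).@[y 0] = 0.
  move=> /w0/rowP/(_ i); rewrite !mxE /cross !mxE => <-.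
  by rewrite mevalB !mevalZ; ring.
pose J i j := ((w i)^`M(j)).@[x 0].
pose D t : 'rV[R]_3 := \row_i \sum_j t 0 j * J i j.
have DE t i : dot t (veval (pgrad (g i)) x) = vprod (D t) N 0 i.
  rewrite [RHS]mxE /cross !mxE dotE !mxE !ffunE !mderivB !mderivZ !mevalB !mevalZ.
  by rewrite !sum_ord3 /J; move: (N 0 (i - 1)) (N 0 (i + 1)) => ? ?; ring.
have D1 : vprod (D t1) N = 0.
  apply/rowP => i; rewrite -DE [RHS]mxE.
  by have [] := tri_tangential_deriv0 (g0 i) Tx.
have D2 : vprod (D t2) N = 0.
  apply/rowP => i; rewrite -DE [RHS]mxE.
  by have [] := tri_tangential_deriv0 (g0 i) Tx.
have N1 : dot N t1 = 0 by rewrite NE !dotE !mxE /cross !ord3E; ring.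
have N2 : dot N t2 = 0 by rewrite NE !dotE !mxE /cross !ord3E; ring.
(* [D t] is the derivative of [w] along [t]; as [w] stays parallel to [N] on
   the triangle, so do [D t1] and [D t2], which are thus orthogonal to [t2] and
   [t1]. *)
have cE : dot (veval (pcurl w) x) N = c * (dot (D t1) t2 - dot (D t2) t1).
  rewrite NE !dotE !mxE !ffunE !ord3E !mevalB /cross !ord3E !sum_ord3 -!/(J _ _).
  ring.
have : dot N N * dot (veval (pcurl w) x) N = 0.
  rewrite cE mulrCA mulrBr (dot_parallel D1 N2) (dot_parallel D2 N1).
  by rewrite subr0 mulr0.
(* [N] may be zero, for instance on a degenerate triangle; the claim is then trivial. *)
move/eqP; rewrite mulf_eq0 => /orP[/eqP/dot_eq0 ->|/eqP //].
by rewrite /dot big1 // => i _; rewrite [X in _ * X]mxE mulr0.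
Qed.

End Vectors3.

(** * The discrete complex *)

Section Hulls.

Variables (R : realType) (m : tetmesh R).
Implicit Types f g : {set 'I_(nvtx m)}.

Lemma hull_sub f g : f \subset g -> hull f `<=` hull g.
Proof.
move=> fg x [w [w0 w1 ->]].
pose w' i := if i \in f then w i else 0.
have sumE (V : lmodType R) (F : 'I_(nvtx m) -> R -> V) : (forall i, F i 0 = 0) ->
    \sum_(i in g) F i (w' i) = \sum_(i in f) F i (w i).
  move=> F0; rewrite (finset.big_setID f) /= (finset.setIidPr fg).
  rewrite [X in _ + X]big1 ?addr0.
    by apply: eq_bigr => i fi; rewrite /w' fi.
  by move=> i; rewrite inE => /andP[/negbTE fi _]; rewrite /w' fi F0.
exists w'; split.
- by move=> i; rewrite /w'; case: ifP.
- by rewrite (sumE R^o (fun i y => y)).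
- by rewrite (sumE _ (fun i y => y *: vtx i)) // => i; rewrite scale0r.
Qed.

(** Dropping the barycentric weight of the first vertex leaves the two affine parameters. This links
    faces, given as vertex sets, to the triangle lemmas. *)
Lemma hull_tri f : #|f| = 3%N ->
  hull f = tri_set (face_vtx f 0) (face_vtx f 1 - face_vtx f 0)
                   (face_vtx f 2 - face_vtx f 0).
Proof.
move=> f3; have sE (V : nmodType) (F : 'I_(nvtx m) -> V) :
    \sum_(i in f) F i = \sum_(i <- enum f) F i by rewrite big_enum.
have := enum_uniq (mem f); have : size (enum f) = 3%N by rewrite -cardE.
rewrite /hull /face_vtx; case: (enum f) sE => [|i0 [|i1 [|i2 [|//]]]] //= sE _.
rewrite !inE !negb_or andbT => /andP[/andP[i01 i02] i12].
apply/seteqP; split=> x.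
  move=> [w [w0 + ->]]; rewrite !sE !big_cons !big_nil !addr0 => w1.
  exists (w i1), (w i2); split=> //; first by have := w0 i0; lra.
  rewrite (_ : w i0 = 1 - w i1 - w i2); last by lra.
  by apply/rowP => j; rewrite !mxE; ring.
move=> [s [r [s0 r0 sr ->]]].
exists (fun i => if i == i0 then 1 - s - r else if i == i1 then s else r).
rewrite !sE !big_cons !big_nil !addr0 !eqxx.
rewrite [i1 == i0]eq_sym (negbTE i01) [i2 == i0]eq_sym (negbTE i02).
rewrite [i2 == i1]eq_sym (negbTE i12); split=> [i||]; last 2 first.
- by ring.
- by apply/rowP => j; rewrite !mxE; ring.
by case: ifP => _; [lra|case: ifP].
Qed.

End Hulls.

Section Complex.

Variables (R : realType) (S O : set 'rV[R]_3) (m : tetmesh R) (k : nat).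

Lemma veval_linear (a : R) (u v : vpoly R) x :
  veval (a *: u + v) x = a *: veval u x + veval v x.
Proof. by apply/rowP => i; rewrite !mxE !ffunE mevalD mevalZ. Qed.

Lemma seval_linear (a : R) (p q : spoly R) x :
  seval (a *: p + q) x = a * seval p x + seval q x.
Proof. by rewrite /seval mevalD mevalZ. Qed.

Lemma deg_le_linear j (a : R) (p q : {mpoly R[3]}) :
  deg_le j p -> deg_le j q -> deg_le j (a *: p + q).
Proof.
move=> hp hq; apply: leq_trans (msizeD_le _ _) _; rewrite geq_max hq andbT.
exact: leq_trans (msizeZ_le _ _) hp.
Qed.

Lemma deg_le0 j : deg_le j (0 : {mpoly R[3]}).
Proof. by rewrite /deg_le msize0. Qed.

Lemma deg_leB j (p q : {mpoly R[3]}) : deg_le j p -> deg_le j q -> deg_le j (p - q).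
Proof.
move=> hp hq; have := deg_le_linear (-1) hq hp.
by rewrite scaleN1r addrC.
Qed.

Lemma deg_le_mderiv j (p : {mpoly R[3]}) i : deg_le j.+1 p -> deg_le j p^`M(i).
Proof.
move=> hp; apply: leq_trans (msize_mderiv _ _) _.
by rewrite -subn1 leq_subLR add1n.
Qed.

Lemma deg_leXM j (p : {mpoly R[3]}) i : deg_le j p -> deg_le j.+1 ('X_i * p).
Proof.
have [->|pn0 hp] := eqVneq p 0; first by rewrite mulr0 => _; exact: deg_le0.
have Xn0 : ('X_i : {mpoly R[3]}) != 0 by rewrite -msize_poly_eq0 msizeX.
by rewrite /deg_le msizeM // msizeX mdeg1 add2n ltnS.
Qed.

Lemma deg_leW j (p : {mpoly R[3]}) : deg_le j p -> deg_le j.+1 p.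
Proof. by move=> hp; apply: leq_trans hp _. Qed.

Lemma nedelec_deg u i : nedelec_local k u -> deg_le k.+1 (u i : {mpoly R[3]}).
Proof.
move=> [a [b [ha hb ->]]]; rewrite -[a i]scale1r; apply: deg_le_linear.
  exact: deg_leW.
by apply: deg_leB; exact: deg_leXM.
Qed.

Lemma rt_deg u i : rt_local k u -> deg_le k.+1 (u i : {mpoly R[3]}).
Proof.
move=> [a [b [ha hb ->]]]; rewrite -[a i]scale1r; apply: deg_le_linear.
  exact: deg_leW.
exact: deg_leXM.
Qed.

Lemma face_normalE (f : {set 'I_(nvtx m)}) : exists c : R, face_normal f =
  c *: vprod (face_vtx f 1 - face_vtx f 0) (face_vtx f 2 - face_vtx f 0).
Proof. by eexists. Qed.

Lemma is_face_tri (c : 'I_(ncell m)) f : is_face c f ->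
  hull f = tri_set (face_vtx f 0) (face_vtx f 1 - face_vtx f 0)
                   (face_vtx f 2 - face_vtx f 0).
Proof. by case/andP => _ /eqP /hull_tri. Qed.

Lemma pcurl_face (c : 'I_(ncell m)) f (w : vpoly R) : is_face c f ->
  (forall x, hull f x -> vprod (veval w x) (face_normal f) = 0) ->
  forall x, hull f x -> dot (veval (pcurl w) x) (face_normal f) = 0.
Proof.
move=> /is_face_tri ->; have [s NE] := face_normalE f => w0 x Tx.
exact: (pcurl_normal NE w0 Tx).
Qed.

Lemma pgrad_face (c : 'I_(ncell m)) f (p : spoly R) : is_face c f ->
  (forall x, hull f x -> seval p x = 0) ->
  forall x, hull f x -> vprod (veval (pgrad p) x) (face_normal f) = 0.
Proof.
move=> /is_face_tri ->; have [s ->] := face_normalE f => p0 x Tx.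
exact: (pgrad_normal _ p0 Tx).
Qed.

Lemma pcurlD (u v : vpoly R) : pcurl (u + v) = pcurl u + pcurl v.
Proof. by apply/ffunP => i; rewrite !ffunE !mderivD opprD addrACA. Qed.

Lemma pcurlZ a (u : vpoly R) : pcurl (a *: u) = a *: pcurl u.
Proof. by apply/ffunP => i; rewrite !ffunE !mderivZ scalerBr. Qed.

Lemma pgradD (p q : spoly R) : pgrad (p + q) = pgrad p + pgrad q.
Proof. by apply/ffunP => i; rewrite !ffunE mderivD. Qed.

Lemma pgradZ a (p : spoly R) : pgrad (a *: p) = a *: pgrad p.
Proof. by apply/ffunP => i; rewrite !ffunE mderivZ. Qed.

Lemma pdvg_linear a (u v : vpoly R) : pdvg (a *: u + v) = a *: pdvg u + pdvg v.
Proof.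
rewrite /pdvg scaler_sumr -big_split /=; apply: eq_bigr => i _.
by rewrite !ffunE mderivD mderivZ.
Qed.

Lemma pdvg_pcurl (w : vpoly R) : pdvg (pcurl w) = 0.
Proof.
rewrite /pdvg sum_ord3 !ffunE !ord3E !mderivB.
rewrite [(w 1)^`M(0)^`M(-1)]mderiv_comm [(w 0)^`M(1)^`M(-1)]mderiv_comm.
by rewrite [(w (-1))^`M(1)^`M(0)]mderiv_comm; ring.
Qed.

Lemma pcurl_pgrad (p : spoly R) : pcurl (pgrad p) = 0.
Proof.
by apply/ffunP => i; rewrite !ffunE mderiv_comm subrr.
Qed.

Lemma div_curl (u : vfield m) : div (curl u) = 0.
Proof. by apply/ffunP => c; rewrite !ffunE pdvg_pcurl. Qed.

Lemma curl_grad (p : sfield m) : curl (grad p) = 0.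
Proof. by apply/ffunP => c; rewrite !ffunE pcurl_pgrad. Qed.

Lemma div_linear a (u v : vfield m) : div (a *: u + v) = a *: div u + div v.
Proof. by apply/ffunP => c; rewrite !ffunE pdvg_linear. Qed.

Lemma curl_linear a (u v : vfield m) : curl (a *: u + v) = a *: curl u + curl v.
Proof. by apply/ffunP => c; rewrite !ffunE pcurlD pcurlZ. Qed.

Lemma grad_linear a (p q : sfield m) : grad (a *: p + q) = a *: grad p + grad q.
Proof. by apply/ffunP => c; rewrite !ffunE pgradD pgradZ. Qed.

Lemma veval_sub (u v : vpoly R) x : veval (u - v) x = veval u x - veval v x.
Proof. by apply/rowP => i; rewrite !mxE !ffunE mevalB. Qed.

Lemma dotBl (u v w : 'rV[R]_3) : dot (u - v) w = dot u w - dot v w.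
Proof. by rewrite -scaleN1r dotDl dotZl mulN1r. Qed.

Lemma vprodBl (u v w : 'rV[R]_3) : vprod (u - v) w = vprod u w - vprod v w.
Proof. by rewrite -scaleN1r vprodDl vprodZl scaleN1r. Qed.

Lemma pcurlB (u v : vpoly R) : pcurl (u - v) = pcurl u - pcurl v.
Proof. by rewrite -scaleN1r pcurlD pcurlZ scaleN1r. Qed.

Lemma pgradB (p q : spoly R) : pgrad (p - q) = pgrad p - pgrad q.
Proof. by rewrite -scaleN1r pgradD pgradZ scaleN1r. Qed.

(** On a common face the difference of two neighbouring polynomials has no tangential trace, so its
    curl has no normal trace. Locally the curl has degree at most k, so the [x P_k] part of the
    Raviart-Thomas space is taken to be 0. *)
Lemma curl_Hhimp (u : vfield m) : Hhimp_curl S O k u -> Hhimp_div S O k (curl u).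
Proof.
move=> [loc cont bnd]; split.
- move=> c; rewrite ffunE; exists (pcurl (u c)), 0; split.
  + move=> i; rewrite ffunE.
    by apply: deg_leB; apply: deg_le_mderiv; exact: nedelec_deg.
  + exact: deg_le0.
  + by move=> i; rewrite mulr0 addr0.
- move=> c d f x fc fd fx; apply/eqP; rewrite -subr_eq0 !ffunE -dotBl -veval_sub.
  rewrite -pcurlB; apply/eqP; apply: (pcurl_face fc) fx => y fy.
  by rewrite veval_sub vprodBl (cont c d) // subrr.
- move=> c f x fc fG fx; rewrite ffunE; apply: (pcurl_face fc) fx => y fy.
  exact: bnd.
Qed.

(** Stated for any face in the frontier because it serves twice: on [Gamma_o] it gives the essential
    boundary condition of [grad p], on [Gamma_i] it removes [grad p] from the boundary term. *)
Lemma Gamma_face_frontier (c : 'I_(ncell m)) f (p : sfield m) :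
  Hh0_grad S O k p -> is_face c f ->
  hull f `<=` frontier (exterior S O) ->
  forall x, hull f x -> vprod (veval (pgrad (p c)) x) (face_normal f) = 0.
Proof.
move=> [_ _ bnd] fc fG x fx; apply: (pgrad_face fc) fx => y fy.
apply: bnd; last exact: fG.
by move: fy; apply: hull_sub; case/andP: fc.
Qed.

Lemma grad_Hh0 (p : sfield m) : Hh0_grad S O k p -> Hhimp_curl S O k (grad p).
Proof.
move=> Hp; have [loc cont bnd] := Hp; split.
- move=> c; rewrite ffunE; exists (pgrad (p c)), 0; split.
  + by move=> i; rewrite ffunE; exact: deg_le_mderiv.
  + by move=> i; rewrite ffunE; exact: deg_le0.
  + by move=> i; rewrite /cross !ffunE !mulr0 subrr addr0.
- move=> c d f x fc fd fx; apply/eqP; rewrite -subr_eq0 !ffunE -vprodBl -veval_sub.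
  rewrite -pgradB; apply/eqP; apply: (pgrad_face fc) fx => y fy.
  rewrite /seval mevalB; apply/eqP; rewrite subr_eq0; apply/eqP.
  have /andP[fc' _] := fc; have /andP[fd' _] := fd.
  by apply: cont; [apply: hull_sub fc' _ _|apply: hull_sub fd' _ _].
- move=> c f x fc fG fx; rewrite ffunE; apply: Gamma_face_frontier fx => //.
  by move=> y /fG[].
Qed.

Lemma Hhimp_div_linear a u v : Hhimp_div S O k u -> Hhimp_div S O k v ->
  Hhimp_div S O k (a *: u + v : vfield m).
Proof.
move=> [lu cu bu] [lv cv bv]; split.
- move=> c; have [au [bu' [d1 d2 e1]]] := lu c; have [av [bv' [d3 d4 e2]]] := lv c.
  exists (a *: au + av), (a *: bu' + bv'); split.
  + by move=> i; rewrite !ffunE; exact: deg_le_linear.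
  + exact: deg_le_linear.
  + move=> i; rewrite !ffunE e1 e2 scalerDr mulrDr -scalerAr; ring.
- move=> c d f x fc fd fx; rewrite !ffunE !veval_linear !dotDl !dotZl.
  by rewrite (cu c d) // (cv c d).
- move=> c f x fc fG fx; rewrite !ffunE veval_linear dotDl dotZl.
  by rewrite bu // bv // mulr0 addr0.
Qed.

Lemma Hhimp_curl_linear a u v : Hhimp_curl S O k u -> Hhimp_curl S O k v ->
  Hhimp_curl S O k (a *: u + v : vfield m).
Proof.
move=> [lu cu bu] [lv cv bv]; split.
- move=> c; have [au [bu' [d1 d2 e1]]] := lu c; have [av [bv' [d3 d4 e2]]] := lv c.
  exists (a *: au + av), (a *: bu' + bv'); split.
  + by move=> i; rewrite !ffunE; exact: deg_le_linear.
  + by move=> i; rewrite !ffunE; exact: deg_le_linear.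
  + by move=> i; rewrite /cross !ffunE e1 e2 /cross -!mul_mpolyC; ring.
- move=> c d f x fc fd fx; rewrite !ffunE !veval_linear !vprodDl !vprodZl.
  by rewrite (cu c d) // (cv c d).
- move=> c f x fc fG fx; rewrite !ffunE veval_linear vprodDl vprodZl.
  by rewrite bu // bv // scaler0 addr0.
Qed.

Lemma Hh0_grad_linear a p q : Hh0_grad S O k p -> Hh0_grad S O k q ->
  Hh0_grad S O k (a *: p + q : sfield m).
Proof.
move=> [lu cu bu] [lv cv bv]; split.
- by move=> c; rewrite !ffunE; exact: deg_le_linear.
- move=> c d x xc xd; rewrite !ffunE !seval_linear.
  by rewrite (cu c d) // (cv c d).
- move=> c x xc xF; rewrite !ffunE seval_linear.
  by rewrite (bu c) // (bv c) // mulr0 addr0.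
Qed.

Lemma Hhimp_div0 : Hhimp_div S O k (0 : vfield m).
Proof.
split=> [c|c d f x|c f x] /=; rewrite ?ffunE //.
- exists 0, 0; split=> [i||i]; rewrite ?ffunE ?mulr0 ?addr0 //; exact: deg_le0.
- by rewrite /dot big1 // => i _; rewrite !mxE ffunE meval0 mul0r.
Qed.

Lemma Hhimp_curl0 : Hhimp_curl S O k (0 : vfield m).
Proof.
split=> [c|c d f x|c f x] /=; rewrite ?ffunE //.
- exists 0, 0; split=> i; rewrite /cross ?ffunE ?mulr0 ?subrr ?addr0 //; exact: deg_le0.
- move=> _ _ _; have -> : veval (0 : vpoly R) x = 0.
    by apply/rowP => i; rewrite !mxE ffunE meval0.
  exact: vprod0l.
Qed.

Lemma Hh0_grad0 : Hh0_grad S O k (0 : sfield m).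
Proof.
split=> [c|c d x|c x] /=; rewrite ?ffunE //; first exact: deg_le0.
by rewrite /seval meval0.
Qed.

Lemma ip_Gi_grad p v : Hh0_grad S O k p -> ip_Gi S O (grad p : vfield m) v = 0.
Proof.
move=> Hp; rewrite /ip_Gi big1 // => c _; rewrite big1 // => f /andP[fc /asboolP fG].
rewrite /face_int /tri_int.
(* A degenerate face has area factor 0; on any other one the face normal has unit length, as
   [tang_normal] requires. *)
set N := vprod _ _; have [N0|N0] := eqVneq N 0.
  rewrite /enorm N0 /dot big1 ?sqrtr0 ?mul0r // => i _.
  by rewrite mxE mul0r.
have N1 : dot (face_normal f) (face_normal f) = 1.
  rewrite /face_normal -/N dotZl dotC dotZl mulrA -invfM.
  rewrite -expr2 sqr_sqrtr ?dot_ge0 // mulVf //.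
  by apply: contraNneq N0 => /dot_eq0 ->.
rewrite (_ : Rintegral _ _ _ = 0) ?mulr0 //.
rewrite /Rintegral (eq_integral (cst 0%E)) ?integral0 //= => s.
rewrite inE /= => -[s0 s1 s01]; congr (_%:E).
set x := _ + _ + _; have fx : hull f x.
  by rewrite (is_face_tri fc); exists s.1, s.2.
rewrite ffunE (@tang_normal _ _ (veval (pgrad (p c)) x)) //.
  by rewrite /dot big1 // => i _; rewrite mxE mul0r.
by apply: Gamma_face_frontier fx => // y /fG[].
Qed.

End Complex.

(** * Compactness and interior of tetrahedra *)

Section TetrahedronGeometry.

Variables (R : realType) (m : tetmesh R).
Implicit Types f : {set 'I_(nvtx m)}.

Lemma compact_hull f : compact (hull f).
Proof.
pose n := nvtx m.
pose K : set 'rV[R]_n := [set w | forall i, `[0, 1]%classic (w ord0 i)].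
pose sumf (w : 'rV[R]_n) : R := \sum_(i in f) w 0 i.
pose comb (w : 'rV[R]_n) : 'rV[R]_3 := \sum_(i in f) w 0 i *: vtx i.
have -> : hull f = comb @` (K `&` sumf @^-1` [set 1]).
  apply/seteqP; split=> x; last first.
    move=> [w [wK w1] <-]; exists (fun i => w 0 i); split=> // i.
    by have := wK i; rewrite /= in_itv /= => /andP[].
  (* [hull] does not bound the weights outside [f], so they are reset to 0 in order to land in the
     compact cube [K]. *)
  move=> [w [w0 w1 ->]]; exists (\row_i (if i \in f then w i else 0)).
    split=> [i|]; rewrite /= ?in_itv /= ?mxE.
      case: ifP => fi; last by rewrite lexx ler01.
      by rewrite w0 -w1 (bigD1 i) //= lerDl sumr_ge0.
    by rewrite -w1; apply: eq_bigr => i fi; rewrite mxE fi.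
  by apply: eq_bigr => i fi; rewrite mxE fi.
apply: continuous_compact.
  apply: continuous_subspaceT; apply: continuous_big => [|i _ w].
    exact: add_continuous.
  apply: (@continuous_comp _ _ _ (fun w : 'rV[R]_n => w 0 i) (fun s => s *: vtx i)).
    exact: coord_continuous.
  exact: scalel_continuous.
apply: compact_closedI.
  rewrite /K; apply: (@rV_compact R n (fun=> `[0, 1]%classic)) => _.
  exact: segment_compact.
apply: preimage_closed; last exact: closed_eq.
move=> w _; apply: continuous_big => [|i _]; first exact: add_continuous.
exact: coord_continuous.
Qed.

(** Affine independence makes the edge matrix [M] invertible, so barycentric coordinates depend
    continuously on the point and stay positive near the barycentre. *)
Lemma tet_interior f : #|f| = 4%N -> affine_free f -> (hull f)° !=set0.
Proof.
move=> f4 ff; have sE (V : nmodType) (F : 'I_(nvtx m) -> V) :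
    \sum_(i in f) F i = \sum_(i <- enum f) F i by rewrite big_enum.
have := enum_uniq (mem f); have : size (enum f) = 4%N by rewrite -cardE.
have fE i : (i \in f) = (i \in enum f) by rewrite mem_enum.
move: ff; rewrite /hull /affine_free.
case: (enum f) sE fE => [|i0 [|i1 [|i2 [|i3 [|//]]]]] //= sE fE ff _.
rewrite !inE !negb_or andbT => /andP[/and3P[i01 i02 i03] /andP[/andP[i12 i13] i23]].
pose wt (a b c d : R) i := if i == i0 then a else if i == i1 then b else
  if i == i2 then c else d.
have wtE a b c d : ((wt a b c d i0 = a) * (wt a b c d i1 = b) *
    (wt a b c d i2 = c) * (wt a b c d i3 = d))%type.
  rewrite /wt !eqxx [i1 == i0]eq_sym (negbTE i01) [i2 == i0]eq_sym (negbTE i02).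
  rewrite [i3 == i0]eq_sym (negbTE i03) [i2 == i1]eq_sym (negbTE i12).
  by rewrite [i3 == i1]eq_sym (negbTE i13) [i3 == i2]eq_sym (negbTE i23).
pose e := [:: i1; i2; i3].
pose M : 'M[R]_3 := \matrix_(i, j) (vtx (nth i0 e i) 0 j - vtx i0 0 j).
have mulM (u : 'rV[R]_3) : u *m M = u 0 0 *: (vtx i1 - vtx i0) +
    u 0 1 *: (vtx i2 - vtx i0) + u 0 (-1) *: (vtx i3 - vtx i0).
  by apply/rowP => j; rewrite !mxE sum_ord3 !mxE /=.
have ker0 (u : 'rV[R]_3) : u *m M = 0 -> u = 0.
  move=> u0.
  pose w := wt (- (u 0 0 + u 0 1 + u 0 (-1))) (u 0 0) (u 0 1) (u 0 (-1)).
  have w0 : forall i, i \in f -> w i = 0.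
    apply: ff; rewrite sE !big_cons big_nil /w !wtE; first by ring.
    by rewrite -[RHS]u0 mulM; apply/rowP => j; rewrite !mxE; ring.
  apply: row3P; rewrite [RHS]mxE.
  - by have := w0 i1; rewrite fE !inE eqxx orbT /w wtE; exact.
  - by have := w0 i2; rewrite fE !inE eqxx !orbT /w wtE; exact.
  - by have := w0 i3; rewrite fE !inE eqxx !orbT /w wtE; exact.
have Mu : M \in unitmx.
  rewrite -row_free_unit -kermx_eq0; apply/eqP/row_matrixP => i; rewrite row0.
  by apply: ker0; apply/sub_kermxP; rewrite row_sub.
pose y (x : 'rV[R]_3) : 'rV[R]_3 := (x - vtx i0) *m invmx M.
have cy j : continuous (fun x => y x 0 j).
  under eq_fun do rewrite mxE.
  apply: continuous_big => [|l _ x]; first exact: add_continuous.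
  under eq_fun do rewrite mxE.
  apply: (@continuous_comp _ _ _ (fun x : 'rV[R]_3 => x 0 l)
    (fun s => (s + (- vtx i0) 0 l) * invmx M l j)); first exact: coord_continuous.
  by apply: cvgMr_tmp; apply: cvgD; [exact: cvg_id|exact: cvg_cst].
(* All four weights of [x0] are 1/4. Nearby, three of them stay between 0 and 1/3, which keeps the
   fourth positive. *)
pose x0 := vtx i0 + (const_mx 4^-1) *m M.
have y0 : y x0 = const_mx 4^-1 by rewrite /y /x0 addrC addKr mulmxK.
have c4 : (0 : R) < 4^-1 by rewrite invr_gt0.
exists x0; rewrite /interior.
have y_gt j : \forall x \near x0, 0 < y x 0 j.
  by apply: (cvgr_gt (y x0 0 j) (cy j x0)); rewrite y0 mxE.
have y_lt j : \forall x \near x0, y x 0 j < 3^-1.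
  by apply: (cvgr_lt (y x0 0 j) (cy j x0)); rewrite y0 mxE; lra.
near=> x; rewrite /=.
have [a0 a1 a2] : [/\ 0 < y x 0 0, 0 < y x 0 1 & 0 < y x 0 (-1)].
  by split; near: x; exact: y_gt.
have [b0 b1 b2] : [/\ y x 0 0 < 3^-1, y x 0 1 < 3^-1 & y x 0 (-1) < 3^-1].
  by split; near: x; exact: y_lt.
exists (wt (1 - (y x 0 0 + y x 0 1 + y x 0 (-1))) (y x 0 0) (y x 0 1) (y x 0 (-1))).
rewrite !sE !big_cons !big_nil !wtE; split=> [i||].
    by rewrite /wt; case: ifP => _; [lra|case: ifP => _; [lra|case: ifP => _; lra]].
  by ring.
have : x = vtx i0 + y x *m M by rewrite /y mulmxKV // addrC subrK.
by rewrite mulM => {1}->; apply/rowP => j; rewrite !mxE; ring.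
Unshelve. all: by end_near. Qed.

End TetrahedronGeometry.

(** * Linear algebra *)

Section FiniteDimensional.

Variables (R : realType) (V : lmodType R) (H : set V).
Hypothesis H0 : H 0.
Hypothesis Hlin : forall (c : R) u v, H u -> H v -> H (c *: u + v).

Definition lincomb d (b : 'I_d -> V) (c : 'rV[R]_d) : V := \sum_i c 0 i *: b i.

Lemma functional_on0 (l : V -> R) : functional_on H l -> l 0 = 0.
Proof.
by move=> ll; have := ll (-1) _ _ H0 H0; rewrite scaler0 addr0 mulN1r addNr.
Qed.

Lemma lincomb_in d (b : 'I_d -> V) c : (forall i, H (b i)) -> H (lincomb b c).
Proof.
move=> Hb; rewrite /lincomb; elim/big_ind: _ => // [u v Hu Hv|i _].
  by rewrite -[u]scale1r; exact: Hlin.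
by rewrite -[_ *: _]addr0; exact: Hlin.
Qed.

Lemma functional_lincomb (l : V -> R) d (b : 'I_d -> V) c : functional_on H l ->
  (forall i, H (b i)) -> l (lincomb b c) = \sum_i c 0 i * l (b i).
Proof.
move=> ll Hb; have l0 := functional_on0 ll.
(* [l] is linear on [H] only, so the induction carries membership along. *)
pose K x r := H x /\ l x = r.
suff [] : K (lincomb b c) (\sum_i c 0 i * l (b i)) by [].
apply: (big_ind2 K) => // [u r v s [Hu <-] [Hv <-]|i _].
  by split; rewrite -[u]scale1r; [exact: Hlin|rewrite ll // mul1r scale1r].
by split; rewrite -[_ *: _]addr0; [exact: Hlin|rewrite ll // l0 addr0].
Qed.

Variables (n : nat) (phi : V -> 'rV[R]_n).
Hypothesis phi_linear : forall (c : R) u v, phi (c *: u + v) = c *: phi u + phi v.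
Hypothesis phi_inj : forall u, H u -> phi u = 0 -> u = 0.

Let phi0 : phi 0 = 0.
Proof. by have := phi_linear (-1) 0 0; rewrite scaler0 addr0 scaleN1r addNr. Qed.

Let phi_lincomb d (b : 'I_d -> V) c :
  phi (lincomb b c) = c *m \matrix_i phi (b i).
Proof.
have -> : phi (lincomb b c) = \sum_i c 0 i *: phi (b i).
  apply: (big_ind2 (fun x y => phi x = y)) => //.
    by move=> u _ v _ <- <-; rewrite -[u]scale1r phi_linear !scale1r.
  by move=> i _; rewrite -[_ *: b i]addr0 phi_linear phi0 addr0.
by rewrite mulmx_sum_row; apply: eq_bigr => i _; rewrite rowK.
Qed.

(** Take a longest family in [H] with independent images: its length is at most [n], and a vector of
    [H] outside its span would lengthen it. *)
Lemma finite_basis : exists d (b : 'I_d -> V), [/\ forall i, H (b i),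
  row_free (\matrix_i phi (b i)) & forall y, H y -> exists c, y = lincomb b c].
Proof.
pose P d := `[< exists b : 'I_d -> V,
  (forall i, H (b i)) /\ row_free (\matrix_i phi (b i)) >].
have P0 : exists d, P d.
  exists 0; apply/asboolP; exists (fun=> 0); split=> //.
  by rewrite /row_free -leqn0 rank_leq_row.
have Pn d : P d -> (d <= n)%N.
  by move=> /asboolP[b [_ /eqP<-]]; exact: rank_leq_col.
have [d /asboolP[b [Hb fb]] dmax] := ex_maxnP P0 Pn.
exists d, b; split=> // y Hy; pose B := \matrix_i phi (b i).
have /submxP[c yc] : (phi y <= B)%MS.
  apply: contraT => yB; suff /dmax : P d.+1 by rewrite ltnn.
  apply/asboolP.
  exists (fun i : 'I_(1 + d) => if fintype.split i is inr j then b j else y).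
  split=> [i|]; first by case: fintype.splitP.
  rewrite (_ : \matrix_i _ = col_mx (phi y) B); last first.
    apply/row_matrixP => i; rewrite rowK.
    case: fintype.splitP => j ij.
      have -> : i = lshift d j by exact/val_inj.
      by rewrite rowKu (ord1 j) row_id.
    have -> : i = rshift 1 j by exact/val_inj.
    by rewrite rowKd rowK.
  have rE : \rank (col_mx (phi y) B) = \rank (phi y + B)%MS.
    by apply/esym; have [] := addsmxE (phi y) B.
  rewrite /row_free eqn_leq rank_leq_row /= rE.
  have : (B < phi y + B)%MS.
    by rewrite /ltmx addsmxSr /=; apply: contra yB; exact: submx_trans (addsmxSl _ _).
  by rewrite ltmxErank (eqP fb) => /andP[].
exists c; apply/eqP; rewrite -subr_eq0; apply/eqP; apply: phi_inj.
  rewrite addrC -scaleN1r; apply: Hlin => //; exact: lincomb_in.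
by rewrite addrC -scaleN1r phi_linear phi_lincomb -yc scaleN1r addNr.
Qed.

(** In a basis of [H] this is a square linear system with matrix [A]; a nonzero kernel vector of [A]
    would be a nonzero x with a(x, .) = 0 on [H]. *)
Lemma nondegenerate_solvable (a : V -> V -> R) (g : V -> R) :
  (forall x, H x -> functional_on H (a x)) ->
  (forall y, H y -> functional_on H (a ^~ y)) ->
  (forall x, H x -> (forall y, H y -> a x y = 0) -> x = 0) ->
  functional_on H g ->
  exists2 x, H x & forall y, H y -> a x y = g y.
Proof.
move=> aR aL nd gl; have [d [b [Hb fb spanb]]] := finite_basis.
pose A := \matrix_(i, j) a (b i) (b j).
have aE c j : a (lincomb b c) (b j) = (c *m A) 0 j.
  rewrite (functional_lincomb _ (aL _ (Hb j)) Hb) mxE.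
  by apply: eq_bigr => i _; rewrite mxE.
have uA : A \in unitmx.
  rewrite -row_free_unit -kermx_eq0; apply/eqP/row_matrixP => i; rewrite row0.
  set u := row i _; have u0 : u *m A = 0 by apply/sub_kermxP; rewrite row_sub.
  have x0 : lincomb b u = 0.
    apply: nd => [|y /spanb[c ->]]; first exact: lincomb_in.
    rewrite (functional_lincomb _ (aR _ (lincomb_in _ Hb)) Hb) big1 // => j _.
    by rewrite aE u0 mxE mulr0.
  have := phi_lincomb b u; rewrite x0 phi0 => /esym/eqP.
  by rewrite mulmx_free_eq0 // => /eqP.
exists (lincomb b (\row_j g (b j) *m invmx A)); first exact: lincomb_in.
move=> y /spanb[c ->].
rewrite (functional_lincomb _ (aR _ (lincomb_in _ Hb)) Hb).
rewrite (functional_lincomb _ gl Hb); apply: eq_bigr => j _.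
by rewrite aE mulmxKV // mxE.
Qed.

End FiniteDimensional.

(** * The inner products *)

Section SemiInner.

Variables (R : realType) (V : lmodType R).

(** Only semidefinite, as the boundary form has to be an instance and it vanishes on gradients of
    [Hh0_grad]. *)
Definition semi_inner (b : V -> V -> R) : Prop :=
  [/\ forall a u v w, b (a *: u + v) w = a * b u w + b v w,
      forall u v, b u v = b v u & forall u, 0 <= b u u].

Variables (b : V -> V -> R) (bP : semi_inner b).

Lemma semi_innerC u v : b u v = b v u. Proof. by case: bP. Qed.

Lemma semi_inner_ge0 u : 0 <= b u u. Proof. by case: bP. Qed.

Lemma semi_innerPl a u v w : b (a *: u + v) w = a * b u w + b v w.
Proof. by case: bP. Qed.

Lemma semi_innerPr a u v w : b w (a *: u + v) = a * b w u + b w v.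
Proof. by rewrite !(semi_innerC w) semi_innerPl. Qed.

Lemma semi_inner_sqr a u v :
  b (a *: u + v) (a *: u + v) = a ^+ 2 * b u u + 2 * a * b u v + b v v.
Proof. by rewrite semi_innerPl !semi_innerPr (semi_innerC v u); ring. Qed.

Lemma cauchy_schwarz u v : b u v ^+ 2 <= b u u * b v v.
Proof.
have := semi_inner_ge0 u; rewrite le_eqVlt => /predU1P[/esym uu|uu].
  rewrite uu mul0r; have [->|uv] := eqVneq (b u v) 0; first by rewrite expr0n.
  (* When [b u u] is 0 the square is affine in the multiple of [u]; this multiple gives it the value
     -1. *)
  have := semi_inner_ge0 (- (b v v + 1) / (2 * b u v) *: u + v).
  rewrite semi_inner_sqr uu mulr0 add0r.
  have -> : 2 * (- (b v v + 1) / (2 * b u v)) * b u v = - (b v v + 1) by field.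
  lra.
have := semi_inner_ge0 (- (b u v / b u u) *: u + v).
rewrite semi_inner_sqr.
have -> : (- (b u v / b u u)) ^+ 2 * b u u + 2 * - (b u v / b u u) * b u v + b v v
  = (b u u * b v v - b u v ^+ 2) / b u u by field; rewrite gt_eqF.
by rewrite pmulr_lge0 ?invr_gt0 // subr_ge0.
Qed.

(** [al] and [be] are the weights of the two arguments in the norms; a coefficient that is their
    geometric mean costs no constant. *)
Lemma cauchy_schwarz_weighted u v (al be ka X Y : R) :
  0 <= al -> 0 <= be -> 0 <= X -> 0 <= Y -> ka ^+ 2 = al * be ->
  al * b u u <= X ^+ 2 -> be * b v v <= Y ^+ 2 -> `|ka * b u v| <= X * Y.
Proof.
move=> al0 be0 X0 Y0 kaE uX vY.
rewrite -(ler_pXn2r (n := 2)) ?nnegrE ?mulr_ge0 // real_normK ?num_real // exprMn kaE.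
apply: (@le_trans _ _ ((al * b u u) * (be * b v v))); last first.
  by rewrite exprMn ler_pM // mulr_ge0 // semi_inner_ge0.
by rewrite [leRHS]mulrACA; apply: ler_wpM2l; rewrite ?mulr_ge0 // cauchy_schwarz.
Qed.

End SemiInner.

Section FieldForms.

Variables (R : realType) (m : tetmesh R).

(** Keeps the integrands polynomial up to the weight, so that continuity and the zero lemmas
    apply. *)
Definition pdot (u v : vpoly R) : {mpoly R[3]} := \sum_i u i * v i.

Lemma dot_veval (u v : vpoly R) x : dot (veval u x) (veval v x) = (pdot u v).@[x 0].
Proof.
rewrite /pdot /dot raddf_sum; apply: eq_bigr => i _.
by rewrite !mxE /= mevalM.
Qed.

Lemma pdot_linear a (u v w : vpoly R) : pdot (a *: u + v) w = a *: pdot u w + pdot v w.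
Proof.
rewrite /pdot scaler_sumr -big_split; apply: eq_bigr => i _ /=.
by rewrite !ffunE mulrDl scalerAl.
Qed.

Lemma pdotC (u v : vpoly R) : pdot u v = pdot v u.
Proof. by apply: eq_bigr => i _; rewrite mulrC. Qed.

(** Valid for [n] of any length; the factor n . n - 2 is -1 for a unit normal. *)
Lemma dot_tang n (u v : 'rV[R]_3) :
  dot (tang n u) (tang n v) = dot u v + (dot n n - 2) * (dot u n * dot v n).
Proof. by rewrite /tang !dotE !mxE; ring. Qed.

Lemma continuous_dot_tang n (u v : vpoly R) :
  continuous (fun x => dot (tang n (veval u x)) (tang n (veval v x))).
Proof.
pose pn (w : vpoly R) : {mpoly R[3]} := \sum_i n 0 i *: w i.
have pnE w x : dot (veval w x) n = (pn w).@[x 0].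
  rewrite /pn /dot raddf_sum; apply: eq_bigr => i _.
  by rewrite mxE /= mevalZ mulrC.
have -> : (fun x => dot (tang n (veval u x)) (tang n (veval v x))) =
    fun x => (pdot u v + (dot n n - 2) *: (pn u * pn v)).@[x 0].
  by apply/funext => x; rewrite dot_tang mevalD mevalZ mevalM dot_veval !pnE.
exact: continuous_meval.
Qed.

Variable w : 'rV[R]_3 -> R.
Hypothesis w_cont : forall c : 'I_(ncell m), {within tet c, continuous w}.
Hypothesis w_gt0 : forall (c : 'I_(ncell m)) x, tet c x -> 0 < w x.

Let wp_cont (c : 'I_(ncell m)) (p : {mpoly R[3]}) :
  {within tet c, continuous (fun x => w x * p.@[x 0])}.
Proof.
move=> x; apply: cvgM; first exact: w_cont.
apply: (continuous_subspaceT (f := fun x : 'rV[R]_3 => p.@[x 0])).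
exact: continuous_meval.
Qed.

Let vol_int_w_linear (c : 'I_(ncell m)) a (p q : {mpoly R[3]}) :
  vol_int (tet c) (fun x => w x * (a *: p + q).@[x 0]) =
  a * vol_int (tet c) (fun x => w x * p.@[x 0]) +
  vol_int (tet c) (fun x => w x * q.@[x 0]).
Proof.
rewrite -vol_int_linear //; last exact: compact_hull.
by congr (vol_int _ _); apply/funext => x; rewrite mevalD mevalZ; ring.
Qed.

Lemma ip_vE (u v : vfield m) : ip_v w u v =
  \sum_c vol_int (tet c) (fun x => w x * (pdot (u c) (v c)).@[x 0]).
Proof.
by apply: eq_bigr => c _; congr (vol_int _ _); apply/funext => x; rewrite dot_veval.
Qed.

Lemma ip_sE (p q : sfield m) : ip_s w p q =
  \sum_c vol_int (tet c) (fun x => w x * (p c * q c).@[x 0]).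
Proof.
by apply: eq_bigr => c _; congr (vol_int _ _); apply/funext => x; rewrite mevalM.
Qed.

Lemma semi_inner_ip_v : semi_inner (@ip_v R m w).
Proof.
split=> [a u v z|u v|u]; rewrite !ip_vE.
- rewrite mulr_sumr -big_split; apply: eq_bigr => c _ /=.
  by rewrite !ffunE pdot_linear vol_int_w_linear.
- by apply: eq_bigr => c _; rewrite pdotC.
- apply: sumr_ge0 => c _; apply: vol_int_ge0 => x cx.
  by rewrite -dot_veval mulr_ge0 ?dot_ge0 // ltW // (w_gt0 cx).
Qed.

Lemma semi_inner_ip_s : semi_inner (@ip_s R m w).
Proof.
split=> [a u v z|u v|u]; rewrite !ip_sE.
- rewrite mulr_sumr -big_split; apply: eq_bigr => c _ /=.
  by rewrite !ffunE mulrDl -scalerAl vol_int_w_linear.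
- by apply: eq_bigr => c _; rewrite mulrC.
- apply: sumr_ge0 => c _; apply: vol_int_ge0 => x cx.
  by rewrite mevalM -expr2 mulr_ge0 ?sqr_ge0 // ltW // (w_gt0 cx).
Qed.

Hypothesis cells : forall c : 'I_(ncell m), #|cell c| = 4%N /\ affine_free (cell c).

Let vol_int_w_eq0 (c : 'I_(ncell m)) (p : {mpoly R[3]}) :
  (forall x : 'rV[R]_3, 0 <= p.@[x 0]) ->
  vol_int (tet c) (fun x => w x * p.@[x 0]) = 0 ->
  forall x : 'rV[R]_3, (tet c)° x -> p.@[x 0] = 0.
Proof.
move=> p0 int0 x cx.
have w0 y : tet c y -> 0 <= w y * p.@[y 0].
  by move=> cy; rewrite mulr_ge0 // ltW // (w_gt0 cy).
have := vol_int_eq0 (@compact_hull _ _ _) (@wp_cont c p) w0 int0 (@open_interior _ _)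
  (@interior_subset _ _) cx.
move/eqP; rewrite mulf_eq0 => /orP[/eqP w_0|/eqP //].
by have := w_gt0 (interior_subset cx); rewrite w_0 ltxx.
Qed.

Let interior0 (c : 'I_(ncell m)) (p : {mpoly R[3]}) :
  (forall x : 'rV[R]_3, (tet c)° x -> p.@[x 0] = 0) -> p = 0.
Proof.
apply: mpoly_eq0_open; first exact: open_interior.
by have [c4 cf] := cells c; exact: tet_interior.
Qed.

Lemma ip_v_definite (u : vfield m) : ip_v w u u = 0 -> u = 0.
Proof.
rewrite ip_vE => /eqP; rewrite psumr_eq0 => [/allP u0|c _]; last first.
  apply: vol_int_ge0 => x cx.
  by rewrite -dot_veval mulr_ge0 ?dot_ge0 // ltW // (w_gt0 cx).
apply/ffunP => c; apply/ffunP => i; rewrite !ffunE; apply: (@interior0 c) => x cx.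
have /eqP int0 := u0 c (mem_index_enum _).
have p_ge0 (y : 'rV[R]_3) : 0 <= (pdot (u c) (u c)).@[y 0].
  by rewrite -dot_veval dot_ge0.
have := vol_int_w_eq0 p_ge0 int0 cx; rewrite -dot_veval => /dot_eq0/rowP/(_ i).
by rewrite !mxE.
Qed.

Lemma ip_s_definite (p : sfield m) : ip_s w p p = 0 -> p = 0.
Proof.
rewrite ip_sE => /eqP; rewrite psumr_eq0 => [/allP u0|c _]; last first.
  apply: vol_int_ge0 => x cx.
  by rewrite mevalM -expr2 mulr_ge0 ?sqr_ge0 // ltW // (w_gt0 cx).
apply/ffunP => c; rewrite !ffunE; apply: (@interior0 c) => x cx.
have /eqP int0 := u0 c (mem_index_enum _).
have p_ge0 (y : 'rV[R]_3) : 0 <= (p c * p c).@[y 0].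
  by rewrite mevalM -expr2 sqr_ge0.
have := vol_int_w_eq0 p_ge0 int0 cx.
by rewrite mevalM => /eqP; rewrite mulf_eq0 orbb => /eqP.
Qed.

End FieldForms.

Lemma semi_inner_ip_Gi (R : realType) (S O : set 'rV[R]_3) (m : tetmesh R) :
  semi_inner (@ip_Gi R S O m).
Proof.
have tang_linear n a (u v : 'rV[R]_3) : tang n (a *: u + v) = a *: tang n u + tang n v.
  by apply/rowP => i; rewrite /tang !mxE dotDl dotZl; ring.
split=> [a u v z|u v|u]; rewrite /ip_Gi.
- rewrite mulr_sumr -big_split; apply: eq_bigr => c _ /=.
  rewrite mulr_sumr -big_split; apply: eq_bigr => f _ /=.
  rewrite /face_int -tri_int_linear; try exact: continuous_dot_tang.
  congr (tri_int _ _ _ _); apply/funext => x.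
  by rewrite !ffunE veval_linear tang_linear dotDl dotZl.
- apply: eq_bigr => c _; apply: eq_bigr => f _.
  by congr (tri_int _ _ _ _); apply/funext => x; rewrite dotC.
- apply: sumr_ge0 => c _; apply: sumr_ge0 => f _.
  by apply: tri_int_ge0 => x; exact: dot_ge0.
Qed.

(** * The inf-sup condition and well-posedness *)

Section AbstractInfSup.

Variables (R : realType) (W P : lmodType R).
Variables (bm be bG : W -> W -> R) (bs : P -> P -> R).
Hypotheses (bmP : semi_inner bm) (beP : semi_inner be).
Hypotheses (bGP : semi_inner bG) (bsP : semi_inner bs).
Variables (curl : W -> W) (grad : P -> W) (div : W -> P).
Hypothesis curl_lin : forall a u v, curl (a *: u + v) = a *: curl u + curl v.
Hypothesis div_lin : forall a u v, div (a *: u + v) = a *: div u + div v.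
Hypothesis grad_lin : forall a p q, grad (a *: p + q) = a *: grad p + grad q.
Hypothesis curl_grad0 : forall p, curl (grad p) = 0.
Hypothesis div_curl0 : forall u, div (curl u) = 0.
Variables (s t g : R).
Hypotheses (s_ge0 : 0 <= s) (t_ge0 : 0 <= t) (st1 : s * t = 1) (g_ge0 : 0 <= g).

(** [aform] for abstract forms: [s], [t] and [g] stand for 2/tau, tau/2 and 1 + gamma, and tau is
    seen only through s t = 1 and signs. *)
Definition mixed_form (B E : W) (p : P) (C F : W) (q : P) : R :=
  s * bm B C + bm (curl E) C + bs (div B) (div C)
  + s * be E F + be (grad p) F - bm B (curl F)
  + g * bG E F
  + s * bs p q - be E (grad q).

Definition energy (B E : W) (p : P) : R :=
  s * bm B B + bs (div B) (div B) +
  (s * be E E + t * bm (curl E) (curl E) + g * bG E E) +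
  (s * bs p p + t * be (grad p) (grad p)).

Lemma mixed_form_linearl a B E p B' E' p' C F q :
  mixed_form (a *: B + B') (a *: E + E') (a *: p + p') C F q =
  a * mixed_form B E p C F q + mixed_form B' E' p' C F q.
Proof.
rewrite /mixed_form curl_lin div_lin grad_lin !(semi_innerPl bmP).
by rewrite !(semi_innerPl beP) !(semi_innerPl bsP) (semi_innerPl bGP); ring.
Qed.

Lemma mixed_form_linearr a B E p C F q C' F' q' :
  mixed_form B E p (a *: C + C') (a *: F + F') (a *: q + q') =
  a * mixed_form B E p C F q + mixed_form B E p C' F' q'.
Proof.
rewrite /mixed_form curl_lin div_lin grad_lin !(semi_innerPr bmP).
by rewrite !(semi_innerPr beP) !(semi_innerPr bsP) (semi_innerPr bGP); ring.
Qed.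

(** The factor 1 on the divergence gives it the shape that [cauchy_schwarz_weighted] expects. *)
Lemma energy_terms_le B E p :
  [/\ s * bm B B <= energy B E p, 1 * bs (div B) (div B) <= energy B E p,
      s * be E E <= energy B E p & t * bm (curl E) (curl E) <= energy B E p] /\
  [/\ g * bG E E <= energy B E p, s * bs p p <= energy B E p,
      t * be (grad p) (grad p) <= energy B E p & 0 <= energy B E p].
Proof.
have h1 := mulr_ge0 s_ge0 (semi_inner_ge0 bmP B).
have h2 := semi_inner_ge0 bsP (div B).
have h3 := mulr_ge0 s_ge0 (semi_inner_ge0 beP E).
have h4 := mulr_ge0 t_ge0 (semi_inner_ge0 bmP (curl E)).
have h5 := mulr_ge0 g_ge0 (semi_inner_ge0 bGP E).
have h6 := mulr_ge0 s_ge0 (semi_inner_ge0 bsP p).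
have h7 := mulr_ge0 t_ge0 (semi_inner_ge0 beP (grad p)).
by rewrite mul1r /energy; split; split; lra.
Qed.

(** Up to sign, each coefficient is the geometric mean of the norm weights of its two arguments: s
    of s and s, 1 of s and t or of 1 and 1, g of g and g. *)
Lemma mixed_form_bounded B E p C F q X Y : 0 <= X -> 0 <= Y ->
  X ^+ 2 = energy B E p -> Y ^+ 2 = energy C F q ->
  `|mixed_form B E p C F q| <= 9 * (X * Y).
Proof.
move=> X0 Y0 XE YE.
have := energy_terms_le B E p; rewrite -XE => -[[xB xd xE xc] [xG xp xg _]].
have := energy_terms_le C F q; rewrite -YE => -[[yB yd yE yc] [yG yp yg _]].
have CS (V : lmodType R) (b : V -> V -> R) : semi_inner b -> forall u v al be' ka,
    0 <= al -> 0 <= be' -> ka ^+ 2 = al * be' -> al * b u u <= X ^+ 2 ->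
    be' * b v v <= Y ^+ 2 -> `|ka * b u v| <= X * Y.
  by move=> bP u v al be' ka al0 be0; apply: cauchy_schwarz_weighted.
have CS1 (V : lmodType R) (b : V -> V -> R) : semi_inner b -> forall u v al be',
    0 <= al -> 0 <= be' -> 1 ^+ 2 = al * be' -> al * b u u <= X ^+ 2 ->
    be' * b v v <= Y ^+ 2 -> `|b u v| <= X * Y.
  by move=> bP u v al be'; rewrite -[b u v]mul1r; exact: CS.
have ts1 : 1 ^+ 2 = t * s by rewrite expr1n mulrC.
have st1' : 1 ^+ 2 = s * t by rewrite expr1n.
have -> : 9 * (X * Y) = X * Y + X * Y + X * Y + X * Y + X * Y + X * Y + X * Y
  + X * Y + X * Y by ring.
have nD (a b A B' : R) : `|a| <= A -> `|b| <= B' -> `|a + b| <= A + B'.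
  by move=> aA bB; rewrite (le_trans (ler_normD _ _)) // lerD.
rewrite /mixed_form.
(* One [nD] for each of the eight additions of the left-nested sum. *)
refine (nD _ _ _ _ (nD _ _ _ _ (nD _ _ _ _ (nD _ _ _ _ (nD _ _ _ _ (nD _ _ _ _
  (nD _ _ _ _ (nD _ _ _ _ _ _) _) _) _) _) _) _) _).
- exact: (CS _ _ bmP _ _ _ _ _ s_ge0 s_ge0 (expr2 s) xB yB).
- exact: (CS1 _ _ bmP _ _ _ _ t_ge0 s_ge0 ts1 xc yB).
- exact: (CS1 _ _ bsP _ _ _ _ ler01 ler01 (expr2 1) xd yd).
- exact: (CS _ _ beP _ _ _ _ _ s_ge0 s_ge0 (expr2 s) xE yE).
- exact: (CS1 _ _ beP _ _ _ _ t_ge0 s_ge0 ts1 xg yE).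
- by rewrite normrN; exact: (CS1 _ _ bmP _ _ _ _ s_ge0 t_ge0 st1' xB yc).
- exact: (CS _ _ bGP _ _ _ _ _ g_ge0 g_ge0 (expr2 g) xG yG).
- exact: (CS _ _ bsP _ _ _ _ _ s_ge0 s_ge0 (expr2 s) xp yp).
- by rewrite normrN; exact: (CS1 _ _ beP _ _ _ _ s_ge0 t_ge0 st1' xE yg).
Qed.

(* [0 <= t * b (s u + v, s u + v)], simplified with [s t = 1]. *)
Lemma weighted_sqr_ge0 b (u v : W) : semi_inner b ->
  0 <= s * b u u + 2 * b u v + t * b v v /\ 0 <= s * b u u - 2 * b u v + t * b v v.
Proof.
move=> bP.
have h r : r ^+ 2 = s ^+ 2 -> 0 <= s * b u u + 2 * (r * t) * b u v + t * b v v.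
  move=> r2; have -> : s * b u u + 2 * (r * t) * b u v + t * b v v =
      t * b (r *: u + v) (r *: u + v).
    rewrite (semi_inner_sqr bP) r2 -{1}[s]mul1r -st1; ring.
  by rewrite mulr_ge0 // (semi_inner_ge0 bP).
have := h s erefl; have := h (- s); rewrite sqrrN mulNr st1 => /(_ erefl).
by move=> h1 h2; split; lra.
Qed.

(** After cancellation one net copy of [bm B (curl E)] and one of [be E (grad p)] survive; half of
    the neighbouring squares absorbs them, and the other half is what remains. *)
Lemma mixed_form_coercive B E p : bG (grad p) E = 0 ->
  2^-1 * energy B E p <= mixed_form B E p (t *: curl E + B) (t *: grad p + E) p.
Proof.
move=> Gp0; rewrite /energy /mixed_form.
rewrite !curl_lin !div_lin div_curl0 curl_grad0 !scaler0 !add0r.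
rewrite !(semi_innerPr bmP) !(semi_innerPr beP) (semi_innerPr bGP).
rewrite (semi_innerC bGP E (grad p)) Gp0 mulr0 add0r.
have [h1 _] := weighted_sqr_ge0 B (curl E) bmP.
have [h2 _] := weighted_sqr_ge0 E (grad p) beP.
have h3 := semi_inner_ge0 bsP (div B).
have h4 := mulr_ge0 g_ge0 (semi_inner_ge0 bGP E).
have h5 := mulr_ge0 s_ge0 (semi_inner_ge0 bsP p).
rewrite !(semi_innerC bmP (curl E) B) !(semi_innerC beP (grad p) E).
by rewrite !mulrDr !(mulrA s t) st1 !mul1r; lra.
Qed.

(** Bounding the cross terms by squares yields the factor 3; it is rounded up to the square 4 so
    that norms grow by at most 2. *)
Lemma energy_test_le B E p : bG (grad p) E = 0 -> bG (grad p) (grad p) = 0 ->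
  energy (t *: curl E + B) (t *: grad p + E) p <= 4 * energy B E p.
Proof.
move=> Gp0 Gpp0; rewrite /energy.
rewrite !curl_lin !div_lin div_curl0 curl_grad0 !scaler0 !add0r.
rewrite (semi_inner_sqr bmP) (semi_inner_sqr beP) (semi_inner_sqr bGP).
rewrite Gp0 Gpp0 !mulr0 !add0r.
have [_ h1] := weighted_sqr_ge0 B (curl E) bmP.
have [_ h2] := weighted_sqr_ge0 E (grad p) beP.
have h3 := semi_inner_ge0 bsP (div B).
have h4 := mulr_ge0 g_ge0 (semi_inner_ge0 bGP E).
have h5 := mulr_ge0 s_ge0 (semi_inner_ge0 bsP p).
have h6 := mulr_ge0 s_ge0 (semi_inner_ge0 bmP B).
have h7 := mulr_ge0 s_ge0 (semi_inner_ge0 beP E).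
have h8 := mulr_ge0 t_ge0 (semi_inner_ge0 bmP (curl E)).
have h9 := mulr_ge0 t_ge0 (semi_inner_ge0 beP (grad p)).
have E1 (y : R) : s * (t ^+ 2 * y) = t * y.
  by rewrite expr2 !mulrA st1 mul1r.
have E2 (y : R) : s * (2 * t * y) = 2 * y.
  by rewrite (mulrC 2) -!mulrA (mulrA s) st1 mul1r.
rewrite (semi_innerC bmP (curl E) B) (semi_innerC beP (grad p) E).
by rewrite !(mulrDr s) !E1 !E2; lra.
Qed.

End AbstractInfSup.

(** * Coefficient vectors of discrete fields *)

Section Coordinates.

Variables (R : realType) (m : tetmesh R) (d : nat).

Definition coord_idx : finType :=
  (('I_(ncell m) * 'I_3 * 'X_{1..3 < d}) + ('I_(ncell m) * 'I_3 * 'X_{1..3 < d})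
   + ('I_(ncell m) * 'X_{1..3 < d}))%type.

Definition coord_of (x : fields m) (j : coord_idx) : R :=
  match j with
  | inl (inl (c, i, n)) => (x.1.1 c i)@_n
  | inl (inr (c, i, n)) => (x.1.2 c i)@_n
  | inr (c, n) => (x.2 c)@_n
  end.

Definition field_coords (x : fields m) : 'rV[R]_#|coord_idx| :=
  \row_j coord_of x (enum_val j).

Lemma field_coords_linear (a : R) (x y : fields m) :
  field_coords (a *: x + y) = a *: field_coords x + field_coords y.
Proof.
apply/rowP => j; rewrite !mxE; case: (enum_val j) => [[[[c i] n]|[[c i] n]]|[c n]] /=;
  by rewrite !ffunE mcoeffD mcoeffZ.
Qed.

Lemma mpoly_eq0_coeffs (p : {mpoly R[3]}) : (msize p <= d)%N ->
  (forall n : 'X_{1..3 < d}, p@_n = 0) -> p = 0.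
Proof.
move=> pd p0; apply/mpolyP => n; rewrite mcoeff0.
have [nd|dn] := ltnP (mdeg n) d; first exact: (p0 (BMultinom nd)).
by apply: memN_msupp_eq0; apply: msize_mdeg_ge; exact: leq_trans pd dn.
Qed.

End Coordinates.

(** All three local spaces have degree at most k + 1, and coordinates record the monomials of degree
    strictly below k + 2. *)
Lemma field_coords_inj (R : realType) (S O : set 'rV[R]_3) (m : tetmesh R) (k : nat)
    (x : fields m) :
  Vh S O m k x -> field_coords k.+2 x = 0 -> x = 0.
Proof.
case: x => [[B E] p] [/= [lB _ _] [lE _ _] [lp _ _]] x0.
have {x0}coef0 (j : coord_idx m k.+2) : coord_of ((B, E), p) j = 0 :> R.
  by have /rowP/(_ (enum_rank j)) := x0; rewrite !mxE enum_rankK.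
have -> : B = 0.
  apply/ffunP => c; apply/ffunP => i; rewrite !ffunE.
  apply: (@mpoly_eq0_coeffs _ k.+2); first exact: rt_deg.
  by move=> n; exact: (coef0 (inl (inl (c, i, n)))).
have -> : E = 0.
  apply/ffunP => c; apply/ffunP => i; rewrite !ffunE.
  apply: (@mpoly_eq0_coeffs _ k.+2); first exact: nedelec_deg.
  by move=> n; exact: (coef0 (inl (inr (c, i, n)))).
have -> // : p = 0.
apply/ffunP => c; rewrite !ffunE; apply: (@mpoly_eq0_coeffs _ k.+2); first exact: lp.
by move=> n; exact: (coef0 (inr (c, n))).
Qed.

Lemma recip_within (R : realType) (A : set 'rV[R]_3) (w : 'rV[R]_3 -> R) :
  {within A, continuous w} -> (forall x, A x -> 0 < w x) ->
  {within A, continuous (recip w)}.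
Proof.
move=> cw w0; rewrite continuous_subspace_in => x; rewrite inE => Ax.
by apply: cvgV; [rewrite gt_eqF // w0|exact: cw].
Qed.

(** * The discrete problem on a mesh *)

Section InfSup.

Variables (R : realType) (S O : set 'rV[R]_3) (m : tetmesh R) (k : nat).
Variables (tau gamma : R) (eps mu : 'rV[R]_3 -> R).
Hypothesis mesh : mesh_of m (exterior S O).
Hypothesis tau_gt0 : 0 < tau.
Hypothesis gamma_ge : 0 <= 1 + gamma.
Hypothesis eps_pos : positive_coef (exterior S O) eps.
Hypothesis mu_pos : positive_coef (exterior S O) mu.

Let tet_closure (c : 'I_(ncell m)) : tet c `<=` closure (exterior S O).
Proof. by case: mesh => _ _ _ <- x cx; exists c. Qed.

Let cells (c : 'I_(ncell m)) : #|cell c| = 4%N /\ affine_free (cell c).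
Proof. by case: mesh. Qed.

Let coef_cont w : positive_coef (exterior S O) w ->
  forall c : 'I_(ncell m), {within tet c, continuous w}.
Proof. by case=> cw _ c; apply: continuous_subspaceW cw; exact: tet_closure. Qed.

Let coef_gt0 w : positive_coef (exterior S O) w ->
  forall (c : 'I_(ncell m)) x, tet c x -> 0 < w x.
Proof. by case=> _ w0 c x /tet_closure; exact: w0. Qed.

Let mui_cont (c : 'I_(ncell m)) : {within tet c, continuous (recip mu)}.
Proof. by apply: recip_within; [exact: coef_cont|exact: coef_gt0]. Qed.

Let mui_gt0 (c : 'I_(ncell m)) x : tet c x -> 0 < recip mu x.
Proof. by move=> cx; rewrite invr_gt0 (coef_gt0 mu_pos cx). Qed.

Let one_cont (c : 'I_(ncell m)) : {within tet c, continuous (cst 1 : 'rV[R]_3 -> R)}.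
Proof. by apply: continuous_subspaceT; exact: cst_continuous. Qed.

Local Notation bm := (@ip_v R m (recip mu)).
Local Notation be := (@ip_v R m eps).
Local Notation bs := (@ip_s R m (cst 1)).
Local Notation bG := (@ip_Gi R S O m).
Local Notation V := (Vh S O m k).
Local Notation a := (@aform R S O m tau gamma eps mu).
Local Notation nrm := (@norm_Vh R S O m tau gamma eps mu).

Let bmP : semi_inner bm := semi_inner_ip_v mui_cont mui_gt0.
Let beP : semi_inner be := semi_inner_ip_v (coef_cont eps_pos) (coef_gt0 eps_pos).
Let bsP : semi_inner bs := semi_inner_ip_s one_cont (fun _ _ _ => ltr01).
Let bGP : semi_inner bG := semi_inner_ip_Gi S O m.

Let s_gt0 : 0 < 2 / tau. Proof. by rewrite divr_gt0. Qed.
Let t_gt0 : 0 < tau / 2. Proof. by rewrite divr_gt0. Qed.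
Let st1 : 2 / tau * (tau / 2) = 1. Proof. by field; rewrite gt_eqF. Qed.

Local Notation energy_Vh := (energy bm be bG bs (@curl R m) (@grad R m) (@div R m)
  (2 / tau) (tau / 2) (1 + gamma)).

Let energy_terms B E p := energy_terms_le bmP beP bGP bsP (@curl R m) (@grad R m)
  (@div R m) (ltW s_gt0) (ltW t_gt0) gamma_ge B E p.

Lemma norm_Vh_sqr B E p : nrm ((B, E), p) ^+ 2 = energy_Vh B E p.
Proof. by rewrite sqr_sqrtr //; have [_ []] := energy_terms B E p. Qed.

Lemma norm_Vh_ge0 x : 0 <= nrm x.
Proof. exact: sqrtr_ge0. Qed.

Lemma norm_Vh_definite x : nrm x = 0 -> x = 0.
Proof.
case: x => [[B E] p] N0; have := energy_terms B E p.
rewrite -norm_Vh_sqr N0 expr0n /= => -[[hB _ hE _] [_ hp _ _]].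
have form0 (r : R) : 0 <= r -> 2 / tau * r <= 0 -> r = 0.
  by move=> r0; rewrite pmulr_rle0 // => r1; apply/eqP; rewrite eq_le r0 r1.
have B0 : B = 0.
  apply: (ip_v_definite mui_cont mui_gt0 cells).
  exact: form0 (semi_inner_ge0 bmP B) hB.
have E0 : E = 0.
  apply: (ip_v_definite (coef_cont eps_pos) (coef_gt0 eps_pos) cells).
  exact: form0 (semi_inner_ge0 beP E) hE.
have p0 : p = 0.
  apply: (ip_s_definite one_cont (fun _ _ _ => ltr01) cells).
  exact: form0 (semi_inner_ge0 bsP p) hp.
by rewrite B0 E0 p0.
Qed.

Lemma aform_bounded x y : `|a x y| <= 9 * nrm x * nrm y.
Proof.
have := norm_Vh_ge0 x; have := norm_Vh_ge0 y; rewrite -mulrA.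
case: x => [[B E] p]; case: y => [[C F] q] Y0 X0.
exact: (mixed_form_bounded bmP beP bGP bsP (ltW s_gt0) (ltW t_gt0) st1 gamma_ge X0 Y0
  (norm_Vh_sqr B E p) (norm_Vh_sqr C F q)).
Qed.

Lemma aform_functionall y : functional_on V (a ^~ y).
Proof.
case: y => [[C F] q] r [[B E] p] [[B' E'] p'] _ _.
exact: (mixed_form_linearl bmP beP bGP bsP (@curl_linear R m) (@div_linear R m)
  (@grad_linear R m)).
Qed.

Lemma aform_functionalr x : functional_on V (a x).
Proof.
case: x => [[C F] q] r [[B E] p] [[B' E'] p'] _ _.
exact: (mixed_form_linearr bmP beP bGP bsP (@curl_linear R m) (@div_linear R m)
  (@grad_linear R m)).
Qed.

Lemma Vh0 : V 0.
Proof. by split; [exact: Hhimp_div0|exact: Hhimp_curl0|exact: Hh0_grad0]. Qed.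

Lemma Vh_linear r x y : V x -> V y -> V (r *: x + y).
Proof.
move=> [xB xE xp] [yB yE yp]; split.
- exact: Hhimp_div_linear.
- exact: Hhimp_curl_linear.
- exact: Hh0_grad_linear.
Qed.

Definition test_field (x : fields m) : fields m :=
  ((tau / 2 *: curl x.1.2 + x.1.1, tau / 2 *: grad x.2 + x.1.2), x.2).

Lemma test_field_in x : V x -> V (test_field x).
Proof.
case: x => [[B E] p] [/= HB HE Hp]; split=> //=.
  by apply: Hhimp_div_linear => //; exact: curl_Hhimp.
by apply: Hhimp_curl_linear => //; exact: grad_Hh0.
Qed.

Lemma test_field_coercive x : V x -> 2^-1 * nrm x ^+ 2 <= a x (test_field x).
Proof.
case: x => [[B E] p] [/= HB HE Hp]; rewrite norm_Vh_sqr.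
apply: (mixed_form_coercive bmP beP bGP bsP (@curl_linear R m) (@div_linear R m)
  (@curl_grad R m) (@div_curl R m) (ltW s_gt0) (ltW t_gt0) st1 gamma_ge).
exact: ip_Gi_grad Hp.
Qed.

Lemma test_field_bounded x : V x -> nrm (test_field x) <= 2 * nrm x.
Proof.
case: x => [[B E] p] [/= HB HE Hp].
rewrite -(ler_pXn2r (n := 2)) ?nnegrE ?mulr_ge0 ?norm_Vh_ge0 //.
have N1 : nrm (test_field ((B, E), p)) ^+ 2 = energy_Vh _ _ _ := norm_Vh_sqr _ _ _.
have -> : (2 * nrm ((B, E), p)) ^+ 2 = 4 * energy_Vh B E p.
  by rewrite -norm_Vh_sqr exprMn -natrX.
rewrite N1; apply: (energy_test_le bmP beP bGP bsP (@curl_linear R m) (@div_linear R m)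
  (@curl_grad R m) (@div_curl R m) (ltW s_gt0) (ltW t_gt0) st1 gamma_ge);
  exact: ip_Gi_grad Hp.
Qed.

(** The quotient is at least half of the squared norm divided by twice the norm. Positivity of
    [a x y] also shows that the test field is nonzero. *)
Lemma inf_sup_witness x : V x -> 0 < nrm x ->
  exists y, [/\ V y, y != 0 & 4^-1 * nrm x <= a x y / nrm y].
Proof.
move=> Vx x0; have Ty := test_field_coercive Vx; set y := test_field x in Ty.
have axy0 : 0 < a x y.
  by apply: lt_le_trans Ty; rewrite mulr_gt0 ?invr_gt0 ?exprn_gt0.
have yn0 : y != 0.
  apply: contraTneq axy0 => ->.
  by rewrite (functional_on0 Vh0 (aform_functionalr x)) ltxx.
have y0 : 0 < nrm y.
  rewrite lt_neqAle norm_Vh_ge0 andbT eq_sym.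
  by apply: contra yn0 => /eqP/norm_Vh_definite ->.
exists y; split=> //; first exact: test_field_in.
rewrite ler_pdivlMr //; apply: le_trans Ty.
apply: (@le_trans _ _ (4^-1 * nrm x * (2 * nrm x))).
  by rewrite ler_wpM2l ?mulr_ge0 ?norm_Vh_ge0 // test_field_bounded.
by rewrite le_eqVlt; apply/orP; left; apply/eqP; field.
Qed.

Lemma quotient_le x y : `|a x y| / nrm y <= 9 * nrm x.
Proof.
(* Division by 0 yields 0, which satisfies the bound. *)
have [->|y0] := eqVneq (nrm y) 0.
  by rewrite invr0 mulr0 mulr_ge0 ?norm_Vh_ge0.
by rewrite ler_pdivrMr ?aform_bounded // lt_neqAle eq_sym y0 norm_Vh_ge0.
Qed.

Lemma aform_inf_sup x : V x ->
  4^-1 * nrm x <= sup [set a x y / nrm y | y in [set y | V y /\ y != 0]].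
Proof.
move=> Vx; set A := [set _ | _ in _].
(* An unbounded set would have [sup] 0 by default, so this bound comes first. *)
have ubA : has_ubound A.
  exists (9 * nrm x) => _ [y _ <-]; apply: le_trans (quotient_le x y).
  by rewrite ler_wpM2r ?invr_ge0 ?norm_Vh_ge0 // ler_norm.
(* For x = 0 the supremum must be nonnegative: every quotient is 0, and if V_h is trivial the
   supremum of the empty set is 0. *)
have [x0|x0] := eqVneq (nrm x) 0; last first.
  have {}x0 : 0 < nrm x by rewrite lt_neqAle eq_sym x0 norm_Vh_ge0.
  have [y [Vy y0 xy]] := inf_sup_witness Vx x0.
  by apply: le_trans xy (ub_le_sup ubA _); exists y.
rewrite x0 mulr0; have [[r Ar]|A0] := pselect (A !=set0).
  apply: le_trans (ub_le_sup ubA Ar); case: Ar => y [Vy _] <-.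
  rewrite (norm_Vh_definite x0).
  by rewrite (functional_on0 Vh0 (aform_functionall y)) mul0r.
by rewrite (_ : A = set0) ?sup0 //; apply/seteqP; split=> // r Ar; case: A0; exists r.
Qed.

Lemma aform_nondegenerate x : V x -> (forall y, V y -> a x y = 0) -> x = 0.
Proof.
move=> Vx a0; apply: norm_Vh_definite; apply/eqP.
have := test_field_coercive Vx; rewrite a0; last exact: test_field_in.
by rewrite pmulr_rle0 ?invr_gt0 // => x0; rewrite -sqrf_eq0 eq_le x0 sqr_ge0.
Qed.

Lemma functional_split g : split_data S O m k g -> functional_on V g.
Proof.
move=> [gB [gE [gp [lB lE lp ->]]]] r x y [xB xE xp] [yB yE yp] /=.
by rewrite lB // lE // lp //; ring.
Qed.

Lemma aform_well_posed : well_posed V nrm a (split_data S O m k).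
Proof.
(* Inverse of the inf-sup constant, fixed before [g]. *)
exists 4 => g /functional_split lg.
have [x Vx ax] := nondegenerate_solvable Vh0 Vh_linear
  (@field_coords_linear R m k.+2) (@field_coords_inj R S O m k)
  (fun x _ => aform_functionalr x) (fun y _ => aform_functionall y)
  aform_nondegenerate lg.
exists x.
  split=> // z [Vz az]; apply/eqP; rewrite -subr_eq0; apply/eqP.
  rewrite addrC -scaleN1r; apply: aform_nondegenerate; first exact: Vh_linear.
  move=> y Vy; rewrite (aform_functionall y) //.
  by rewrite az // ax // mulN1r addNr.
rewrite /dual_norm; set A := [set _ | _ in _].
(* Boundedness of [g] comes from the solution: on V_h it equals [a x], whose quotients are
   bounded. *)
have ubA : has_ubound A.
  by exists (9 * nrm x) => _ [y [Vy _] <-]; rewrite -ax //; exact: quotient_le.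
have [x0|x0] := eqVneq (nrm x) 0; last first.
  have {}x0 : 0 < nrm x by rewrite lt_neqAle eq_sym x0 norm_Vh_ge0.
  have [y [Vy y0 xy]] := inf_sup_witness Vx x0.
  rewrite mulrC -ler_pdivrMr // mulrC; apply: le_trans xy _.
  apply: le_trans (ub_le_sup ubA _); last by exists y.
  by rewrite ax // ler_wpM2r ?invr_ge0 ?norm_Vh_ge0 // ler_norm.
rewrite x0 mulr_ge0 //; have [[r Ar]|A0] := pselect (A !=set0).
  apply: le_trans (ub_le_sup ubA Ar); case: Ar => y _ <-.
  by rewrite mulr_ge0 ?invr_ge0 ?norm_Vh_ge0.
by rewrite (_ : A = set0) ?sup0 //; apply/seteqP; split=> // r Ar; case: A0; exists r.
Qed.

End InfSup.

Theorem theorem3p1 (R : realType) (S O : set 'rV[R]_3) (gamma : R) (k : nat)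
    (geom : scattering_geometry S O) (gamma_ge : 0 <= 1 + gamma) :
  exists C0 : R,
  forall (m : tetmesh R) (tau : R) (eps mu : 'rV[R]_3 -> R),
    mesh_of m (exterior S O) -> 0 < tau ->
    positive_coef (exterior S O) eps -> positive_coef (exterior S O) mu ->
    let V := Vh S O m k in
    let a := aform S O tau gamma eps mu in
    let nrm := norm_Vh S O tau gamma eps mu in
    [/\ forall x, V x ->
          sup [set a x y / nrm y | y in [set y | V y /\ y != 0]]
            >= 4^-1 * nrm x,
        forall x y, V x -> V y -> a x y <= C0 * nrm x * nrm y &
        well_posed V nrm a (split_data S O m k)].
Proof.
exists 9 => m tau eps mu mesh tau_gt0 eps_pos mu_pos V a nrm; split.
- by move=> x Vx; exact: aform_inf_sup.
- by move=> x y _ _; rewrite (le_trans (ler_norm _)) //; exact: aform_bounded.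
- exact: aform_well_posed.
Qed.
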